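(* Let $\mathcal U,\mathcal A$ be $\mathfrak h$-bialgebroids with a pairing $\langle\cdot,\cdot\rangle:\mathcal U\times\mathcal A\to D_{\mathfrak h^*}$. For $X\in\mathcal U_{\alpha\beta}$ and $a\in\mathcal A$ the elements $$a\cdot X=\bigl(T_\alpha\langle X,\cdot\rangle\otimes\mathrm{Id}\bigr)\Delta^{\mathcal A}(a)=\sum_{(a)}\mu_l^{\mathcal A}\bigl(T_\alpha\langle X,a_{(1)}\rangle\mathbf 1\bigr)a_{(2)},$$ $$X\cdot a=\bigl(\mathrm{Id}\otimes\langle X,\cdot\rangle T_\beta\bigr)\Delta^{\mathcal A}(a)=\sum_{(a)}\mu_r^{\mathcal A}\bigl(\langle X,a_{(2)}\rangle T_\beta\mathbf 1\bigr)a_{(1)}$$ are well-defined elements of $\mathcal A$ (extended linearly to all $X\in\mathcal U$), and for $X\in\mathcal U_{\alpha\beta}$, $a\in\mathcal A_{\gamma\delta}$ one has $X\cdot a\in\mathcal A_{\gamma,\delta+\alpha-\beta}$ and $a\cdot X\in\mathcal A_{\gamma+\beta-\alpha,\delta}$. They define a right and a left action of $\mathcal U$ on $\mathcal A$: $$a\cdot(XY)=(a\cdot X)\cdot Y,\qquad(XY)\cdot a=X\cdot(Y\cdot a)\qquad\text{for all }a\in\mathcal A,\ X,Y\in\mathcal U.$$ The two actions commute: $(X\cdot a)\cdot Y=X\cdot(a\cdot Y)$ for all $X,Y\in\mathcal U$, $a\in\mathcal A$. Moreover, with $\Delta^{\mathcal U}(X)=\sum_{(X)}X_{(1)}\otimes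 X_{(2)}$, for all $a,b\in\mathcal A$, $$X\cdot(ab)=\sum_{(X)}(X_{(1)}\cdot a)(X_{(2)}\cdot b),\qquad(ab)\cdot X=\sum_{(X)}(a\cdot X_{(1)})(b\cdot X_{(2)}),$$ $$X\cdot1_{\mathcal A}=\mu_r^{\mathcal A}(\varepsilon^{\mathcal U}(X)\mathbf 1),\qquad1_{\mathcal A}\cdot X=\mu_l^{\mathcal A}(T_\alpha\varepsilon^{\mathcal U}(X)\mathbf 1),\qquad X\in\mathcal U_{\alpha\beta}.$$ If $\mathcal U$ and $\mathcal A$ are paired $\mathfrak h$-Hopf algebroids, then $S^{\mathcal A}(a\cdot S^{\mathcal U}(X))=X\cdot S^{\mathcal A}(a)$ for all $X\in\mathcal U$, $a\in\mathcal A$. If $\mathcal U$ and $\mathcal A$ are paired $\mathfrak h$-Hopf $*$-algebroids with invertible antipodes, then for all $X\in\mathcal U$, $a\in\mathcal A$, $$X\cdot a^*=\bigl(S^{\mathcal U}(X)^*\cdot a\bigr)^*=\bigl(S^{\mathcal U}(X^\dagger)\cdot a\bigr)^*,\qquad a^*\cdot X=\bigl(a\cdot S^{\mathcal U}(X)^*\bigr)^*=\bigl(a\cdot S^{\mathcal U}(X^\dagger)\bigr)^*,$$ where the expressions with $*$ on $\mathcal U$ refer to the $*$-type pairing and those with $\dagger$ to the $\dagger$-type pairing (see context).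
   Context: $\mathfrak h$ is a finite-dimensional complex vector space with dual $\mathfrak h^*$; $M_{\mathfrak h^*}$ is the field of meromorphic functions on $\mathfrak h^*$; $\mathbf 1\in M_{\mathfrak h^*}$ is the constant function $1$; $(T_\alpha f)(\lambda)=f(\lambda+\alpha)$. An $\mathfrak h$-algebra is a unital associative algebra $\mathcal A=\bigoplus_{\alpha,\beta\in\mathfrak h^*}\mathcal A_{\alpha\beta}$, bigraded, with algebra embeddings $\mu_l^{\mathcal A},\mu_r^{\mathcal A}:M_{\mathfrak h^*}\to\mathcal A_{00}$ (left and right moment maps) with commuting images such that $\mu_l^{\mathcal A}(f)a=a\mu_l^{\mathcal A}(T_\alpha f)$, $\mu_r^{\mathcal A}(f)a=a\mu_r^{\mathcal A}(T_\beta f)$ for $a\in\mathcal A_{\alpha\beta}$. $D_{\mathfrak h^*}$ is the $\mathfrak h$-algebra of finite difference operators $\sum_if_iT_{\alpha_i}$ on $M_{\mathfrak h^*}$, with $fT_{-\alpha}\in(D_{\mathfrak h^*})_{\alpha\alpha}$, $(D_{\mathfrak h^*})_{\alpha\beta}=0$ for $\alpha\ne\beta$, both moment maps being multiplication operators. For $P\in D_{\mathfrak h^*}$, $P\mathbf 1\in M_{\mathfrak h^*}$ is $P$ applied to $\mathbf 1$; $T_\alpha\langle X,a\rangle$ denotes the product in $D_{\mathfrak h^*}$. $\mathcal A\widetilde\otimes\mathcal B$ has $(\mathcal A\widetilde\otimes\mathcal B)_{\alpha\beta}=\bigoplus_\gamma\mathcal A_{\alpha\gamma}\otimes\mathcal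 B_{\gamma\beta}$ modulo $\mu_r^{\mathcal A}(f)a\otimes b=a\otimes\mu_l^{\mathcal B}(f)b$, with moment maps $\mu_l^{\mathcal A}(f)\otimes1$, $1\otimes\mu_r^{\mathcal B}(f)$ and componentwise product; $\mathcal A\widetilde\otimes D_{\mathfrak h^*}\cong\mathcal A\cong D_{\mathfrak h^*}\widetilde\otimes\mathcal A$ via $a\otimes fT_{-\beta}=\mu_r^{\mathcal A}(f)a$, $fT_{-\alpha}\otimes a=\mu_l^{\mathcal A}(f)a$ for $a\in\mathcal A_{\alpha\beta}$. An $\mathfrak h$-bialgebroid is an $\mathfrak h$-algebra with coassociative $\Delta^{\mathcal A}:\mathcal A\to\mathcal A\widetilde\otimes\mathcal A$ and counit $\varepsilon^{\mathcal A}:\mathcal A\to D_{\mathfrak h^*}$ (with $(\varepsilon\otimes\mathrm{Id})\Delta=\mathrm{Id}=(\mathrm{Id}\otimes\varepsilon)\Delta$), both algebra homomorphisms preserving moment maps and bigrading. Sweedler components are taken homogeneous: $\Delta(a)=\sum_{(a)}a_{(1)}\otimes a_{(2)}$. An $\mathfrak h$-Hopf algebroid is an $\mathfrak h$-bialgebroid with a $\mathbb C$-linear map $S$ with $S(\mu_r(f)a)=S(a)\mu_l(f)$, $S(a\mu_l(f))=\mu_r(f)S(a)$, $m(\mathrm{Id}\otimes S)\Delta(a)=\mu_l(\varepsilon(a)\mathbf 1)$ for all $a$ and $m(S\otimes\mathrm{Id})\Delta(a)=\mu_r(T_\alpha(\varepsilon(a)\mathbf 1))$ for $a\in\mathcal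 A_{\alpha\beta}$. Then $S$ is antimultiplicative, $S(\mathcal A_{\alpha\beta})\subseteq\mathcal A_{-\beta,-\alpha}$, $\Delta S=P(S\otimes S)\Delta$. On $D_{\mathfrak h^*}$: $S^D(fT_\alpha)=T_{-\alpha}\circ f$. For the $*$-statements, $\mathfrak h^*$ has a conjugation and $\bar f(\lambda)=\overline{f(\bar\lambda)}$. A $*$-operator on an $\mathfrak h$-algebra is an antilinear antimultiplicative involution with $\mu_l(f)^*=\mu_l(\bar f)$, $\mu_r(f)^*=\mu_r(\bar f)$; on $D_{\mathfrak h^*}$, $(fT_\alpha)^*=T_{-\bar\alpha}\circ\bar f$. An $\mathfrak h$-Hopf $*$-algebroid is an $\mathfrak h$-Hopf algebroid with a $*$-operator such that $( *\otimes* )\Delta=\Delta*$ and $\varepsilon*=*\varepsilon$. A pairing of $\mathfrak h$-bialgebroids is a $\mathbb C$-bilinear map $\langle\cdot,\cdot\rangle:\mathcal U\times\mathcal A\to D_{\mathfrak h^*}$ with: $\langle\mathcal U_{\alpha\beta},\mathcal A_{\gamma\delta}\rangle\subseteq(D_{\mathfrak h^*})_{\alpha+\delta,\beta+\gamma}$; $\langle\mu_l^{\mathcal U}(f)X,a\rangle=\langle X,\mu_l^{\mathcal A}(f)a\rangle=f\circ\langle X,a\rangle$; $\langle X\mu_r^{\mathcal U}(f),a\rangle=\langle X,a\mu_r^{\mathcal A}(f)\rangle=\langle X,a\rangle\circ f$; $\langle XY,a\rangle=\sum\langle X,a_{(1)}\rangle T_\rho\langle Y,a_{(2)}\rangle$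 with $a_{(1)}\in\mathcal A_{\gamma\rho}$; $\langle X,ab\rangle=\sum\langle X_{(1)},a\rangle T_\rho\langle X_{(2)},b\rangle$ with $X_{(1)}\in\mathcal U_{\alpha\rho}$; $\langle X,1\rangle=\varepsilon^{\mathcal U}(X)$, $\langle1,a\rangle=\varepsilon^{\mathcal A}(a)$. For paired $\mathfrak h$-Hopf algebroids one requires in addition $\langle S^{\mathcal U}(X),a\rangle=S^D(\langle X,S^{\mathcal A}(a)\rangle)$. Paired $\mathfrak h$-Hopf $*$-algebroids: $\mathcal U,\mathcal A$ are $\mathfrak h$-Hopf algebroids with invertible antipodes, paired as $\mathfrak h$-Hopf algebroids, $\mathcal A$ is an $\mathfrak h$-Hopf $*$-algebroid, and $\mathcal U$ is an $\mathfrak h$-Hopf $*$-algebroid such that for all $a\in\mathcal A_{\gamma\delta}$, $X\in\mathcal U$ either ($*$-type, $*$-operator on $\mathcal U$ denoted $*$) $\langle X^*,a\rangle=T_{-\gamma}\circ(\langle X,S^{\mathcal A}(a)^*\rangle)^*\circ T_{-\delta}$, or ($\dagger$-type, $*$-operator on $\mathcal U$ denoted $\dagger$) $\langle X^\dagger,a\rangle=T_{-\gamma}\circ(\langle X,S^{\mathcal A}(a^* )\rangle)^*\circ T_{-\delta}$. *)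

(* Defs.v *)
From HB Require Import structures.
From mathcomp Require Import all_boot all_order all_algebra.
From mathcomp Require Import complex.
From mathcomp Require Import boolp classical_sets functions.
From mathcomp Require Import interval_inference reals topology normedtype.
From mathcomp Require Import landau derive.

Set Implicit Arguments.
Unset Strict Implicit.
Unset Printing Implicit Defensive.

Import Order.TTheory GRing.Theory Num.Theory numFieldNormedType.Exports.
Import VectorInternalTheory.

Local Open Scope ring_scope.
Local Open Scope quotient_scope.
Local Open Scope classical_set_scope.

Section Generic.
Variable E : topologicalType.
Implicit Types (W D : set E) (P Q : E -> Prop).

(* P holds on an open dense subset of W. *)
Definition generic (W : set E) (P : E -> Prop) :=
  exists D : set E, [/\ open D, D `<=` W, W `<=` closure D & forall x, D x -> P x].

Lemma genericT (W : set E) (P : E -> Prop) :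
  open W -> (forall x, W x -> P x) -> generic W P.
Proof. by move=> oW WP; exists W; split=> //; exact: subset_closure. Qed.

Lemma generic_mono (W : set E) (P Q : E -> Prop) :
  (forall x, P x -> Q x) -> generic W P -> generic W Q.
Proof. by move=> PQ [D [oO OW WO OP]]; exists D; split=> // x /OP/PQ. Qed.

Lemma generic_sub (W W' : set E) (P : E -> Prop) :
  open W' -> W' `<=` W -> generic W P -> generic W' P.
Proof.
move=> oW' sW [D [oO OW WO OP]]; exists (D `&` W'); split.
- exact: openI.
- by move=> x [].
- move=> x W'x B nB; have /(WO _) : W x by exact: sW.
  have nBW : nbhs x (B `&` W') by apply: filterI => //; exact: open_nbhs_nbhs.
  by move=> /(_ _ nBW) [y [Oy [By W'y]]]; exists y.
- by move=> x [/OP].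
Qed.

Lemma genericI (W : set E) (P Q : E -> Prop) :
  generic W P -> generic W Q -> generic W (fun x => P x /\ Q x).
Proof.
move=> [D [oO OW WO OP]] [D' [oO' OW' WO' OQ]]; exists (D `&` D'); split.
- exact: openI.
- by move=> x [/OW].
- move=> x Wx B; rewrite nbhsE => -[B' [oB' B'x] B'B].
  have [y [Oy B'y]] := WO x Wx B' (open_nbhs_nbhs (conj oB' B'x)).
  have nO : nbhs y (D `&` B').
    by apply: open_nbhs_nbhs; split; [exact: openI|].
  have [z [D'z [Oz /B'B Bz]]] := WO' y (OW y Oy) _ nO.
  by exists z.
- by move=> x [/OP Px /OQ].
Qed.

Lemma generic_preimage (t t' : E -> E) (W : set E) (P : E -> Prop) :
  continuous t -> continuous t' -> cancel t t' -> cancel t' t ->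
  generic W P -> generic (t @^-1` W) (P \o t).
Proof.
move=> ct ct' tK t'K [D [oO OW WO OP]]; exists (t @^-1` D); split.
- by apply: open_comp => // x _; exact: ct.
- by move=> x /OW.
- move=> x Wx B nB.
  have nB' : nbhs (t x) (t' @^-1` B) by apply: ct'; rewrite tK.
  have [y [Oy By]] := WO _ Wx _ nB'.
  by exists (t' y); split => //=; rewrite t'K.
- by move=> x /OP.
Qed.
End Generic.

(* Everything below is written over a numClosedFieldType C; the intended C is
   the field R[i] of complex numbers, whose topology is that of its norm. *)
Section Meromorphic.
Variables (C : numClosedFieldType) (V : vectType C).
Local Notation E := 'rV[C]_(dim V).

(* r2v : E -> V is a linear coordinate system, through which V gets its
   topology and complex structure. A meromorphic function is locally a quotient
   of holomorphic functions g / h where h vanishes on no nonempty open set; f is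
   allowed any values off an open dense set, and mero V below identifies two
   such f when they agree on an open dense set. *)
Definition meromorphic (f : V -> C) := forall p : E,
  exists (W : set E) (g h : E -> C), [/\ open_nbhs p W,
    (forall x, W x -> differentiable g x /\ differentiable h x) &
    generic W (fun x => h x != 0 /\ f (r2v x) = g x / h x)].

Definition mfun_pred : {pred V -> C} := fun f => `[< meromorphic f >].

Lemma meromorphic_cst c : meromorphic (fun=> c).
Proof.
move=> p; exists setT, (cst c), (cst 1); split.
- by split => //; exact: openT.
- by move=> x _; split; exact: differentiable_cst.
- apply: genericT; first exact: openT.
  by move=> x _; rewrite oner_neq0 divr1.
Qed.

Lemma mfun_subring_closed : subring_closed mfun_pred.
Proof.
split.
- by apply/asboolP; exact: meromorphic_cst.
- move=> f f' /asboolP mf /asboolP mf'; apply/asboolP => p.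
  have [W [g [h [oW dW gW]]]] := mf p; have [W' [g' [h' [oW' dW' gW']]]] := mf' p.
  exists (W `&` W'), (g * h' - g' * h), (h * h'); split.
  + exact: open_nbhsI.
  + move=> x [/dW[dg dh] /dW'[dg' dh']]; split; last exact: differentiableM.
    by apply: differentiableB; exact: differentiableM.
  + have oI : open (W `&` W') by apply: openI; [exact: oW.1|exact: oW'.1].
    have H1 := generic_sub oI (@subIsetl _ W W') gW.
    have H2 := generic_sub oI (@subIsetr _ W W') gW'.
    apply: generic_mono (genericI H1 H2) => x [[hx fx] [h'x f'x]].
    split; first by rewrite mulf_neq0.
    change (f (r2v x) - f' (r2v x) =
      (g x * h' x - g' x * h x) / (h x * h' x)).
    by rewrite fx f'x -mulNr addf_div // mulNr.
- move=> f f' /asboolP mf /asboolP mf'; apply/asboolP => p.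
  have [W [g [h [oW dW gW]]]] := mf p; have [W' [g' [h' [oW' dW' gW']]]] := mf' p.
  exists (W `&` W'), (g * g'), (h * h'); split.
  + exact: open_nbhsI.
  + by move=> x [/dW[dg dh] /dW'[dg' dh']]; split; exact: differentiableM.
  + have oI : open (W `&` W') by apply: openI; [exact: oW.1|exact: oW'.1].
    have H1 := generic_sub oI (@subIsetl _ W W') gW.
    have H2 := generic_sub oI (@subIsetr _ W W') gW'.
    apply: generic_mono (genericI H1 H2) => x [[hx fx] [h'x f'x]].
    split; first by rewrite mulf_neq0.
    change (f (r2v x) * f' (r2v x) = (g x * g' x) / (h x * h' x)).
    by rewrite fx f'x mulf_div.
Qed.

HB.instance Definition _ := GRing.isSubringClosed.Build _ mfun_pred mfun_subring_closed.

Record mfun := MFun { mfun_val : V -> C ; _ : mfun_val \in mfun_pred }.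
HB.instance Definition _ := [isSub for mfun_val].
HB.instance Definition _ := [Choice of mfun by <:].
HB.instance Definition _ := GRing.SubChoice_isSubComPzRing.Build _ _ mfun (subringClosedP _).
Lemma mfun1_neq0 : 1 != 0 :> mfun.
Proof. by apply/eqP => /(congr1 (fun f => mfun_val f 0))/eqP; rewrite oner_eq0. Qed.
HB.instance Definition _ := GRing.PzSemiRing_isNonZero.Build mfun mfun1_neq0.

Definition null_pred : {pred mfun} :=
  fun f => `[< generic setT (fun x : E => mfun_val f (r2v x) = 0) >].

Lemma null_ideal : idealr_closed null_pred.
Proof.
split.
- by apply/asboolP; apply: genericT => //; exact: openT.
- apply/negP => /asboolP [D [_ _ TO O0]].
  have [x [/O0]] := TO 0 I setT filterT.
  by move/eqP; rewrite oner_eq0.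
- move=> a u v /asboolP u0 /asboolP v0; apply/asboolP.
  apply: generic_mono (genericI u0 v0) => x [ux vx].
  change (mfun_val a (r2v x) * mfun_val u (r2v x) + mfun_val v (r2v x) = 0).
  by rewrite ux vx mulr0 addr0.
Qed.
HB.instance Definition _ := isIdealr.Build _ null_pred null_ideal.

(* The ring of meromorphic functions on V. It is a field (V is connected), but
   only its structure of commutative C-algebra is needed. *)
Definition mero := {ideal_quot null_pred}.
HB.instance Definition _ := GRing.ComNzRing.on mero.
Definition to_mero (f : mfun) : mero := \pi_({ideal_quot null_pred}) f.
Lemma to_mero_zmod : zmod_morphism to_mero.
Proof. exact: (rmorphB \pi_({ideal_quot null_pred})). Qed.
Lemma to_mero_monoid : monoid_morphism to_mero.
Proof.
split; [exact: (rmorph1 \pi_({ideal_quot null_pred}))|].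
exact: (rmorphM \pi_({ideal_quot null_pred})).
Qed.
HB.instance Definition _ := GRing.isZmodMorphism.Build mfun mero to_mero to_mero_zmod.
HB.instance Definition _ := GRing.isMonoidMorphism.Build mfun mero to_mero to_mero_monoid.


Lemma to_meroP (f g : mfun) : to_mero f = to_mero g <->
  generic setT (fun x : E => mfun_val f (r2v x) = mfun_val g (r2v x)).
Proof.
have E1 : (to_mero f = to_mero g) <-> f - g \in null_pred.
  by rewrite Quotient.idealrBE; split=> [/eqP|/eqP].
rewrite {}E1; split=> [/asboolP|] fg; last apply/asboolP.
  by apply: generic_mono fg => x /eqP; rewrite subr_eq0 => /eqP.
by apply: generic_mono fg => x fgx; apply/eqP; rewrite subr_eq0; apply/eqP.
Qed.

Lemma repr_to_mero (f : mfun) : generic setT (fun x : E =>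
  mfun_val (repr (to_mero f : {ideal_quot null_pred})) (r2v x)
  = mfun_val f (r2v x)).
Proof. by apply/to_meroP; rewrite /to_mero reprK. Qed.

Definition cst_mfun (c : C) : mfun := @MFun (fun=> c) (asboolT (meromorphic_cst c)).
Definition scale_mero (c : C) (f : mero) : mero := to_mero (cst_mfun c) * f.

Lemma cst_mfunD : {morph cst_mfun : c d / c + d}. Proof. by move=> c d; exact/val_inj. Qed.
Lemma cst_mfunM : {morph cst_mfun : c d / c * d}. Proof. by move=> c d; exact/val_inj. Qed.
Lemma cst_mfun1 : cst_mfun 1 = 1. Proof. exact/val_inj. Qed.

Lemma scale_meroA a b f : scale_mero a (scale_mero b f) = scale_mero (a * b) f.
Proof. by rewrite /scale_mero mulrA cst_mfunM rmorphM. Qed.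
Lemma scale_mero1 : left_id 1 scale_mero.
Proof. by move=> f; rewrite /scale_mero cst_mfun1 rmorph1 mul1r. Qed.
Lemma scale_meroDr : right_distributive scale_mero +%R.
Proof. by move=> a f g; exact: mulrDr. Qed.
Lemma scale_meroDl f : {morph scale_mero^~ f : a b / a + b}.
Proof. by move=> a b; rewrite /scale_mero cst_mfunD rmorphD mulrDl. Qed.

HB.instance Definition _ := GRing.Zmodule_isLmodule.Build C mero
  scale_meroA scale_mero1 scale_meroDr scale_meroDl.
Lemma scale_meroAl (a : C) (f g : mero) : a *: (f * g) = a *: f * g.
Proof. exact: mulrA. Qed.
HB.instance Definition _ := GRing.Lmodule_isLalgebra.Build C mero scale_meroAl.
HB.instance Definition _ := GRing.Lalgebra_isComAlgebra.Build C mero.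

Lemma meromorphic_transport (phi : C -> C) (t : V -> V) (s s' : E -> E)
    (f : V -> C) :
  continuous s -> continuous s' -> cancel s s' -> cancel s' s ->
  (forall x, r2v (s x) = t (r2v x)) ->
  {morph phi : x y / x / y} -> (forall x, x != 0 -> phi x != 0) ->
  (forall (g : E -> C) x, differentiable g (s x) ->
    differentiable (phi \o g \o s) x) ->
  meromorphic f -> meromorphic (phi \o f \o t).
Proof.
move=> cs cs' sK s'K st phiM phi0 phid mf p.
have [W [g [h [[oW Wp] dW gW]]]] := mf (s p).
exists (s @^-1` W), (phi \o g \o s), (phi \o h \o s); split.
- by split => //; apply: open_comp => // x _; exact: cs.
- by move=> x /dW [dg dh]; split; exact: phid.
- apply: generic_mono (generic_preimage cs cs' sK s'K gW) => x [hx fx].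
  by split; [exact: phi0|rewrite /= -st fx phiM].
Qed.

Lemma shift_continuous (a : V) : continuous (fun x : E => x + v2r a).
Proof.
move=> x; apply: (@continuousD _ _ _ (fun y : E => y) (fun=> v2r a)).
  by move=> ?.
exact: cst_continuous.
Qed.

Lemma meromorphic_shift (a : V) (f : V -> C) :
  meromorphic f -> meromorphic (fun l => f (l + a)).
Proof.
apply: (@meromorphic_transport id (fun l => l + a)
  (fun x => x + v2r a) (fun x => x + v2r (- a))) => //.
- exact: shift_continuous.
- exact: shift_continuous.
- by move=> x; rewrite linearN addrK.
- by move=> x; rewrite linearN subrK.
- by move=> x; rewrite linearD /= v2rK.
- move=> g x dg; apply: (@differentiable_comp _ _ _ _ _ g) => //.
Qed.

Definition shift_mfun (a : V) (f : mfun) : mfun :=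
  MFun (asboolT (meromorphic_shift a (asboolW (valP f)))).

(* (T_a f)(l) = f(l + a) *)
Definition shiftM (a : V) (f : mero) : mero :=
  to_mero (shift_mfun a (repr (f : {ideal_quot null_pred}))).

Lemma shiftM_to_mero a (f : mfun) : shiftM a (to_mero f) = to_mero (shift_mfun a f).
Proof.
apply/to_meroP; have := repr_to_mero f.
have aK : cancel (fun x : E => x + v2r a) (fun x => x + v2r (- a)).
  by move=> x; rewrite linearN addrK.
have aK' : cancel (fun x : E => x + v2r (- a)) (fun x => x + v2r a).
  by move=> x; rewrite linearN subrK.
move=> /(generic_preimage (@shift_continuous a) (@shift_continuous (- a)) aK aK').
by apply: generic_mono => x /=; rewrite linearD /= v2rK.
Qed.

Record conjugation := Conjugation {
  conj_fun :> V -> V;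
  conj_antilinear : forall c (l m : V), conj_fun (c *: l + m) = c^* *: conj_fun l + conj_fun m;
  conj_involutive : involutive conj_fun }.

Section Bar.
Variable cj : conjugation.
Let s (x : E) : E := v2r (cj (r2v x)).

Lemma conj_coordP c x y : s (c *: x + y) = c^* *: s x + s y.
Proof. by rewrite /s linearP conj_antilinear linearP. Qed.

Lemma conj_coordK : involutive s.
Proof. by move=> x; rewrite /s v2rK conj_involutive r2vK. Qed.

Lemma conj_coordD x y : s (x + y) = s x + s y.
Proof. by have := conj_coordP 1 x y; rewrite rmorph1 !scale1r. Qed.

Lemma conj_coord0 : s 0 = 0.
Proof. by have /eqP := conj_coordD 0 0; rewrite addr0 -subr_eq0 opprD addrA subrr sub0r oppr_eq0 => /eqP. Qed.

Lemma conj_coordZ c x : s (c *: x) = c^* *: s x.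
Proof. by have := conj_coordP c x 0; rewrite conj_coord0 !addr0. Qed.

Lemma conj_coord_lipschitz : exists2 K : C, 0 < K & forall x, `|s x| <= K * `|x|.
Proof.
exists (1 + \sum_j `|s 'e_j|) => [|x].
  by rewrite ltr_pwDl// sumr_ge0.
have entry_le j : `|x 0 j| <= `|x|.
  rewrite [leRHS]/Num.Def.normr/= mx_normE -[leLHS]nngE num_le.
  exact: (@le_bigmax _ _ _ _ _ (0, j)).
rewrite mulrDl mul1r ler_wpDl//.
have -> : s x = \sum_j (x 0 j)^* *: s 'e_j.
  rewrite {1}[x]row_sum_delta (big_morph s conj_coordD conj_coord0).
  by apply: eq_bigr => j _; exact: conj_coordZ.
rewrite mulr_suml; apply: le_trans (ler_norm_sum _ _ _) _.
apply: ler_sum => j _; rewrite normrZ norm_conjC mulrC.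
by rewrite ler_wpM2l.
Qed.

Lemma conj_coordB x y : s (x - y) = s x - s y.
Proof. by rewrite conj_coordD -scaleN1r conj_coordZ rmorphN1 scaleN1r. Qed.

Lemma conj_coord_continuous : continuous s.
Proof.
have [K K0 sK] := conj_coord_lipschitz.
move=> x; apply/(@cvgrPdist_le _ _ _ (nbhs (x : E)) (nbhs_filter x)) => e e0; near=> y.
rewrite -conj_coordB (le_trans (sK _))// -ler_pdivlMl//.
near: y; apply: (@cvgr_dist_le _ _ _ (nbhs x) _ id x) => //.
by rewrite mulr_gt0 ?invr_gt0.
Unshelve. all: by end_near. Qed.

Lemma conjC_continuous : continuous (fun z : C => z^*).
Proof.
move=> x; apply/(@cvgrPdist_le _ _ _ (nbhs (x : C)) (nbhs_filter x)) => e e0; near=> y.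
rewrite -rmorphB norm_conjC; near: y.
exact: (@cvgr_dist_le _ _ _ (nbhs x) _ id x).
Unshelve. all: by end_near. Qed.

Lemma differentiable_bar (g : E -> C) x :
  differentiable g (s x) -> differentiable (fun y => (g (s y))^*) x.
Proof.
move=> dg; have [K K0 sK] := conj_coord_lipschitz.
pose L (v : E) : C := ('d g (s x) (s v))^*.
have Llin : linear L.
  move=> c u v; rewrite /L conj_coordP linearP rmorphD; congr (_ + _).
  by rewrite [LHS](rmorphM Num.conj c^*) /= conjCK.
pose Lm := GRing.isLinear.Build _ _ _ _ _ Llin.
pose LL : {linear E -> C^o} := HB.pack L Lm.
have Lc : continuous L.
  move=> v; apply: (@continuous_comp _ _ _ (fun v => 'd g (s x) (s v)) (fun z => z^*)).
    apply: continuous_comp; first exact: conj_coord_continuous.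
    exact: diff_continuous.
  exact: conjC_continuous.
pose F : E -> C^o := fun y => (g (s y))^*.
suff oF : F \o shift x = cst (F x) + (LL : E -> C^o) +o_ (0 : E) id.
  apply/diff_locallyP; rewrite (_ : 'd _ x = LL :> (E -> C^o)) //.
  exact: diff_unique.
apply/eqaddoP => e e0.
have /diff_locally/eqaddoP/(_ (e / K) (divr_gt0 e0 K0)) := dg.
rewrite /= -{1}conj_coord0 => /conj_coord_continuous; apply: (@filterS _ (nbhs (0 : E))) => v.
rewrite /= => Hv.
have -> : (F \o shift x - (cst (F x) + LL)) v =
    ((g \o shift (s x) - (cst (g (s x)) + 'd g (s x))) (s v))^*.
  change ((g (s (v + x)))^* - ((g (s x))^* + ('d g (s x) (s v))^*) =
    (g (s v + s x) - (g (s x) + 'd g (s x) (s v)))^*).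
  by rewrite conj_coordD rmorphB rmorphD.
by rewrite norm_conjC (le_trans Hv)// -mulrA ler_pM2l// ler_pdivrMl.
Qed.

Lemma meromorphic_bar (f : V -> C) :
  meromorphic f -> meromorphic (fun l => (f (cj l))^*).
Proof.
apply: (@meromorphic_transport Num.conj cj s s).
- exact: conj_coord_continuous.
- exact: conj_coord_continuous.
- exact: conj_coordK.
- exact: conj_coordK.
- by move=> x; rewrite v2rK.
- by move=> x y; rewrite rmorphM fmorphV.
- by move=> x; rewrite fmorph_eq0.
- exact: differentiable_bar.
Qed.

Definition bar_mfun (f : mfun) : mfun :=
  MFun (asboolT (meromorphic_bar (asboolW (valP f)))).

(* (bar f)(l) = conj (f (conj l)) *)
Definition barM (f : mero) : mero :=
  to_mero (bar_mfun (repr (f : {ideal_quot null_pred}))).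

Lemma barM_to_mero (f : mfun) : barM (to_mero f) = to_mero (bar_mfun f).
Proof.
apply/to_meroP; have := repr_to_mero f.
move=> /(generic_preimage conj_coord_continuous conj_coord_continuous
  conj_coordK conj_coordK); apply: generic_mono => x /=.
by rewrite v2rK => ->.
Qed.
End Bar.
End Meromorphic.

(* The K-module with generators W subject to the relations "s = 0", s in rel,
   where a list of pairs (c, w) stands for the sum of the c w. *)
Section PresentedModule.
Variables (K : comNzRingType) (W : choiceType).
Local Notation sums := (seq (K * W)).

Definition fs_scale (c : K) (s : sums) : sums := [seq (c * p.1, p.2) | p <- s].

Variable rel : sums -> Prop.

Inductive fs_eq : sums -> sums -> Prop :=
| fs_refl s : fs_eq s s
| fs_sym s t : fs_eq s t -> fs_eq t s
| fs_trans s t u : fs_eq s t -> fs_eq t u -> fs_eq s u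
| fs_cat s s' t t' : fs_eq s t -> fs_eq s' t' -> fs_eq (s ++ s') (t ++ t')
| fs_catC s t : fs_eq (s ++ t) (t ++ s)
| fs_coef0 w : fs_eq [:: (0, w)] [::]
| fs_coefD c d w : fs_eq [:: (c + d, w)] [:: (c, w); (d, w)]
| fs_rel c s : rel s -> fs_eq (fs_scale c s) [::].

Lemma fs_scaleA c d s : fs_scale c (fs_scale d s) = fs_scale (c * d) s.
Proof. by rewrite /fs_scale -map_comp; apply: eq_map => p /=; rewrite mulrA. Qed.

Lemma fs_scale1 s : fs_scale 1 s = s.
Proof. by rewrite /fs_scale -[RHS]map_id; apply: eq_map => -[c w] /=; rewrite mul1r. Qed.

Lemma fs_scale_cat c s t : fs_scale c (s ++ t) = fs_scale c s ++ fs_scale c t.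
Proof. exact: map_cat. Qed.

Lemma fs_scaleE c s t : fs_eq s t -> fs_eq (fs_scale c s) (fs_scale c t).
Proof.
elim=> {s t} [s|s t _|s t u _ + _|s s' t t' _ + _|s t|w|d e w|d s rs].
- exact: fs_refl.
- exact: fs_sym.
- exact: fs_trans.
- by rewrite !fs_scale_cat; exact: fs_cat.
- by rewrite !fs_scale_cat; exact: fs_catC.
- by rewrite /fs_scale /= mulr0; exact: fs_coef0.
- by rewrite /fs_scale /= mulrDr; exact: fs_coefD.
- by rewrite fs_scaleA; exact: fs_rel.
Qed.

Lemma fs_scale0 s : fs_eq (fs_scale 0 s) [::].
Proof.
elim: s => [|[c w] s IH]; first exact: fs_refl.
by rewrite /= mul0r; exact: (fs_cat (fs_coef0 w) IH).
Qed.

Lemma fs_scaleDl c d s : fs_eq (fs_scale (c + d) s) (fs_scale c s ++ fs_scale d s).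
Proof.
elim: s => [|[e w] s IH]; first exact: fs_refl.
rewrite /= mulrDl; apply: fs_trans (fs_cat (fs_coefD _ _ w) IH) _.
apply: (@fs_cat [:: (c * e, w)] _ [:: (c * e, w)]); first exact: fs_refl.
rewrite -cat_cons -[X in fs_eq _ X]cat_rcons -cats1 -cat1s.
by apply: fs_cat; [exact: fs_catC|exact: fs_refl].
Qed.

Definition fs_eqb (s t : sums) : bool := `[< fs_eq s t >].

Lemma fs_eqb_equiv : equiv_class_of fs_eqb.
Proof.
split=> [s|s t|t s u].
- by apply/asboolP; exact: fs_refl.
- by apply/asboolP/asboolP; exact: fs_sym.
- by move=> /asboolP st /asboolP tu; apply/asboolP; exact: fs_trans st tu.
Qed.
Canonical fs_eqb_equiv_rel := EquivRelPack fs_eqb_equiv.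
Canonical fs_eqb_encModRel := defaultEncModRel fs_eqb.

Definition presented := {eq_quot fs_eqb}.
HB.instance Definition _ := Choice.on presented.

Definition to_presented (s : sums) : presented := \pi_({eq_quot fs_eqb}) s.
Definition of_presented (x : presented) : sums := repr (x : {eq_quot fs_eqb}).

Lemma of_presentedK : cancel of_presented to_presented.
Proof. by move=> x; exact: reprK. Qed.

Lemma to_presentedP s t : to_presented s = to_presented t <-> fs_eq s t.
Proof.
split=> [/eqP|st]; first by rewrite /to_presented eqmodE => /asboolP.
by apply/eqP; rewrite /to_presented eqmodE; apply/asboolP.
Qed.

Lemma to_presentedK s : fs_eq (of_presented (to_presented s)) s.
Proof. by apply/to_presentedP; rewrite of_presentedK. Qed.

Definition add_presented x y := to_presented (of_presented x ++ of_presented y).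
Definition scale_presented c x := to_presented (fs_scale c (of_presented x)).

Lemma to_presentedD s t :
  to_presented (s ++ t) = add_presented (to_presented s) (to_presented t).
Proof. by apply/esym/to_presentedP; apply: fs_cat; exact: to_presentedK. Qed.

Lemma to_presentedZ c s :
  to_presented (fs_scale c s) = scale_presented c (to_presented s).
Proof. by apply/esym/to_presentedP; apply: fs_scaleE; exact: to_presentedK. Qed.

Lemma add_presentedA : associative add_presented.
Proof.
move=> x y z; rewrite -[x]of_presentedK -[y]of_presentedK -[z]of_presentedK.
by rewrite -!to_presentedD catA.
Qed.
Lemma add_presentedC : commutative add_presented.
Proof. by move=> x y; apply/to_presentedP; exact: fs_catC. Qed.
Lemma add_presented0 : left_id (to_presented [::]) add_presented.
Proof. by move=> x; rewrite -[x]of_presentedK -to_presentedD. Qed.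
Lemma add_presentedN : left_inverse (to_presented [::]) (scale_presented (-1)) add_presented.
Proof.
move=> x; rewrite -[x]of_presentedK -to_presentedZ -to_presentedD.
rewrite -{2}[of_presented x]fs_scale1; apply/to_presentedP.
apply: fs_trans (fs_sym (fs_scaleDl _ _ _)) _.
by rewrite addNr; exact: fs_scale0.
Qed.
HB.instance Definition _ := GRing.isZmodule.Build presented
  add_presentedA add_presentedC add_presented0 add_presentedN.

Lemma scale_presentedA a b x :
  scale_presented a (scale_presented b x) = scale_presented (a * b) x.
Proof. by rewrite -[x]of_presentedK -!to_presentedZ fs_scaleA. Qed.
Lemma scale_presented1 : left_id 1 scale_presented.
Proof. by move=> x; rewrite -[x]of_presentedK -to_presentedZ fs_scale1. Qed.
Lemma scale_presentedDr : right_distributive scale_presented +%R.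
Proof.
move=> a x y; rewrite -[x]of_presentedK -[y]of_presentedK.
by rewrite -[LHS]/(scale_presented a (add_presented _ _)) -to_presentedD
  -!to_presentedZ fs_scale_cat to_presentedD.
Qed.
Lemma scale_presentedDl x : {morph scale_presented^~ x : a b / a + b}.
Proof.
move=> a b; rewrite -[x]of_presentedK -!to_presentedZ.
by rewrite -[RHS]to_presentedD; apply/to_presentedP; exact: fs_scaleDl.
Qed.
HB.instance Definition _ := GRing.Zmodule_isLmodule.Build K presented
  scale_presentedA scale_presented1 scale_presentedDr scale_presentedDl.
End PresentedModule.

Section DynamicalAlgebras.
Variables (C : numClosedFieldType) (h : vectType C).
Local Notation hs := 'Hom(h, C^o).
Local Notation M := (mero hs).

Section DifferenceOperators.
Implicit Types (P Q : M -> M) (s : seq (M * hs)) (cj : conjugation hs).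

(* The list s = [:: (f_1, a_1); ...; (f_n, a_n)] encodes \sum_i f_i T_{a_i}. *)
Definition fdo s : M -> M := fun g => \sum_(p <- s) p.1 * shiftM p.2 g.

Definition is_fdo P := exists s, P = fdo s.

Definition fdo_deg (al be : hs) P :=
  if al == be then exists f : M, P = (fun g => f * shiftM (- al) g)
  else P = (fun=> 0).

(* Graphs of S^D : \sum f_i T_{a_i} |-> \sum T_{-a_i} o f_i and of
   * : \sum f_i T_{a_i} |-> \sum T_{- conj a_i} o (bar f_i). Both are maps because
   the T_a are linearly independent over M, so that s is determined by fdo s up
   to grouping terms with the same a_i. *)
Definition fdo_antipode P Q := exists s, P = fdo s /\
  Q = (fun g => \sum_(p <- s) shiftM (- p.2) (p.1 * g)).

Definition fdo_star cj P Q := exists s, P = fdo s /\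
  Q = (fun g => \sum_(p <- s) shiftM (- cj p.2) (barM cj p.1 * g)).
End DifferenceOperators.

Record hAlgebra := HAlgebra {
  halg :> algType C;
  hdeg : hs -> hs -> set halg;
  mu_l : {lrmorphism M -> halg};
  mu_r : {lrmorphism M -> halg};
  hdeg0 : forall al be, hdeg al be 0;
  hdegP : forall al be (c : C) a b,
    hdeg al be a -> hdeg al be b -> hdeg al be (c *: a + b);
  hdeg_span : forall a, exists (s : seq (hs * hs)) (c : hs * hs -> halg),
    (forall d, hdeg d.1 d.2 (c d)) /\ a = \sum_(d <- s) c d;
  hdeg_free : forall (s : seq (hs * hs)) (c : hs * hs -> halg),
    uniq s -> (forall d, hdeg d.1 d.2 (c d)) -> \sum_(d <- s) c d = 0 ->
    forall d, d \in s -> c d = 0;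
  hdegM : forall al be ga de a b,
    hdeg al be a -> hdeg ga de b -> hdeg (al + ga) (be + de) (a * b);
  mu_l_inj : injective mu_l;
  mu_r_inj : injective mu_r;
  mu_l_deg : forall f, hdeg 0 0 (mu_l f);
  mu_r_deg : forall f, hdeg 0 0 (mu_r f);
  mu_lrC : forall f g, mu_l f * mu_r g = mu_r g * mu_l f;
  mu_l_shift : forall al be a f,
    hdeg al be a -> mu_l f * a = a * mu_l (shiftM al f);
  mu_r_shift : forall al be a f,
    hdeg al be a -> mu_r f * a = a * mu_r (shiftM be f) }.

Section Tensor.
Variables A B : hAlgebra.

(* The relations of the tensor product over M of A (through mu_r) and B (through
   mu_l), which is the sum of the images of A_{al,ga} (x) B_{ga',be}, followed by
   the vanishing of the summands with ga <> ga'. What remains is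
   \bigoplus_{al,be,ga} A_{al,ga} (x)_M B_{ga,be}. *)
Inductive tensor_rel : seq (C * (A * B)) -> Prop :=
| tensor_linl c a a' b : tensor_rel
    [:: (1, (c *: a + a', b)); (- c, (a, b)); (- 1, (a', b))]
| tensor_linr c a b b' : tensor_rel
    [:: (1, (a, c *: b + b')); (- c, (a, b)); (- 1, (a, b'))]
| tensor_bal f a b : tensor_rel
    [:: (1, (mu_r A f * a, b)); (- 1, (a, mu_l B f * b))]
| tensor_off al ga ga' be a b :
    hdeg al ga a -> hdeg ga' be b -> ga != ga' -> tensor_rel [:: (1, (a, b))].

Definition tensor := presented tensor_rel.
HB.instance Definition _ := GRing.Lmodule.on tensor.

Definition tens (a : A) (b : B) : tensor :=
  to_presented tensor_rel [:: (1, (a, b))].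

Definition tensor_deg (al be : hs) : set tensor := [set x |
  exists n (ga : 'I_n -> hs) (a : 'I_n -> A) (b : 'I_n -> B),
    (forall i, hdeg al (ga i) (a i) /\ hdeg (ga i) be (b i)) /\
    x = \sum_i tens (a i) (b i)].

(* A homogeneous term of a Sweedler sum: hleft in A_{_,hmid}, hright in B_{hmid,_} *)
Record hterm := HTerm {
  hmid : hs; hleft : A; hright : B;
  hleft_deg : exists al, hdeg al hmid hleft;
  hright_deg : exists be, hdeg hmid be hright }.

Definition sweedler (x : tensor) (s : seq hterm) :=
  x = \sum_(t <- s) tens (hleft t) (hright t).
End Tensor.

Section Tensor3.
Variable A : hAlgebra.

(* The threefold analogue of tensor_rel. *)
Inductive tensor3_rel : seq (C * (A * A * A)) -> Prop :=
| tensor3_lin1 c a a' b d : tensor3_rel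
    [:: (1, (c *: a + a', b, d)); (- c, (a, b, d)); (- 1, (a', b, d))]
| tensor3_lin2 c a b b' d : tensor3_rel
    [:: (1, (a, c *: b + b', d)); (- c, (a, b, d)); (- 1, (a, b', d))]
| tensor3_lin3 c a b d d' : tensor3_rel
    [:: (1, (a, b, c *: d + d')); (- c, (a, b, d)); (- 1, (a, b, d'))]
| tensor3_bal12 f a b d : tensor3_rel
    [:: (1, (mu_r A f * a, b, d)); (- 1, (a, mu_l A f * b, d))]
| tensor3_bal23 f a b d : tensor3_rel
    [:: (1, (a, mu_r A f * b, d)); (- 1, (a, b, mu_l A f * d))]
| tensor3_off12 al ga ga' be a b d :
    hdeg al ga a -> hdeg ga' be b -> ga != ga' -> tensor3_rel [:: (1, (a, b, d))]
| tensor3_off23 al ga ga' be a b d :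
    hdeg al ga b -> hdeg ga' be d -> ga != ga' -> tensor3_rel [:: (1, (a, b, d))].

Definition tensor3 := presented tensor3_rel.
HB.instance Definition _ := GRing.Lmodule.on tensor3.

Definition tens3 (a b d : A) : tensor3 :=
  to_presented tensor3_rel [:: (1, (a, b, d))].
End Tensor3.

(* The isomorphisms D (x) A = A and A (x) D = A on elementary tensors:
   f T_{-al} (x) a = mu_l(f) a and a (x) f T_{-be} = mu_r(f) a, where f is the
   value of f T_{-al}, resp. f T_{-be}, at the constant function 1. *)
Definition opl (A : hAlgebra) (P : M -> M) (a : A) : A := mu_l A (P 1) * a.
Definition opr (A : hAlgebra) (a : A) (P : M -> M) : A := mu_r A (P 1) * a.

Record hBialgebroid := HBialgebroid {
  hbialg :> hAlgebra;
  Delta : {linear hbialg -> tensor hbialg hbialg};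
  eps : hbialg -> M -> M;
  Delta1 : Delta 1 = tens 1 1;
  DeltaM : forall a b s t, sweedler (Delta a) s -> sweedler (Delta b) t ->
    Delta (a * b) = \sum_(u <- s) \sum_(v <- t)
      tens (hleft u * hleft v) (hright u * hright v);
  Delta_mu_l : forall f, Delta (mu_l hbialg f) = tens (mu_l hbialg f) 1;
  Delta_mu_r : forall f, Delta (mu_r hbialg f) = tens 1 (mu_r hbialg f);
  Delta_deg : forall al be a, hdeg al be a -> tensor_deg al be (Delta a);
  DeltaA : forall a s (s1 s2 : hterm hbialg hbialg -> seq (hterm hbialg hbialg)),
    sweedler (Delta a) s ->
    (forall t, sweedler (Delta (hleft t)) (s1 t)) ->
    (forall t, sweedler (Delta (hright t)) (s2 t)) ->
    \sum_(t <- s) \sum_(u <- s1 t) tens3 (hleft u) (hright u) (hright t) =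
    \sum_(t <- s) \sum_(u <- s2 t) tens3 (hleft t) (hleft u) (hright u);
  eps_fdo : forall a, is_fdo (eps a);
  eps_linear : forall (c : C) a b g, eps (c *: a + b) g = c *: eps a g + eps b g;
  eps1 : eps 1 = id;
  epsM : forall a b, eps (a * b) = eps a \o eps b;
  eps_mu_l : forall f, eps (mu_l hbialg f) = *%R f;
  eps_mu_r : forall f, eps (mu_r hbialg f) = *%R f;
  eps_deg : forall al be a, hdeg al be a -> fdo_deg al be (eps a);
  eps_left : forall a s, sweedler (Delta a) s ->
    \sum_(t <- s) opl (eps (hleft t)) (hright t) = a;
  eps_right : forall a s, sweedler (Delta a) s ->
    \sum_(t <- s) opr (hleft t) (eps (hright t)) = a }.

Arguments Delta {A} : rename.

Record is_antipode (A : hBialgebroid) (S : {linear A -> A}) : Prop := IsAntipode {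
  antipode_mu_r : forall f a, S (mu_r A f * a) = S a * mu_l A f;
  antipode_mu_l : forall f a, S (a * mu_l A f) = mu_r A f * S a;
  antipode_right : forall a s, sweedler (Delta a) s ->
    \sum_(t <- s) hleft t * S (hright t) = mu_l A (eps a 1);
  antipode_left : forall al be a s, hdeg al be a -> sweedler (Delta a) s ->
    \sum_(t <- s) S (hleft t) * hright t = mu_r A (shiftM al (eps a 1)) }.

Record is_star (cj : conjugation hs) (A : hAlgebra) (st : A -> A) : Prop := IsStar {
  star_antilinear : forall (c : C) a b, st (c *: a + b) = c^* *: st a + st b;
  starM : forall a b, st (a * b) = st b * st a;
  starK : involutive st;
  star_mu_l : forall f, st (mu_l A f) = mu_l A (barM cj f);
  star_mu_r : forall f, st (mu_r A f) = mu_r A (barM cj f) }.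

Record is_hopf_star (cj : conjugation hs) (A : hBialgebroid) (st : A -> A) : Prop :=
  IsHopfStar {
  hopf_star_star : is_star cj st;
  hopf_star_Delta : forall a s, sweedler (Delta a) s ->
    Delta (st a) = \sum_(t <- s) tens (st (hleft t)) (st (hright t));
  hopf_star_eps : forall a Q, fdo_star cj (eps a) Q -> eps (st a) = Q }.

Section Pairing.
Variables (U A : hBialgebroid) (pr : U -> A -> M -> M).

Record is_pairing : Prop := IsPairing {
  pairing_fdo : forall X a, is_fdo (pr X a);
  pairing_linl : forall (c : C) X Y a g,
    pr (c *: X + Y) a g = c *: pr X a g + pr Y a g;
  pairing_linr : forall (c : C) X a b g,
    pr X (c *: a + b) g = c *: pr X a g + pr X b g;
  pairing_deg : forall al be ga de X a, hdeg al be X -> hdeg ga de a ->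
    fdo_deg (al + de) (be + ga) (pr X a);
  pairing_mu_lU : forall f X a, pr (mu_l U f * X) a = (fun g => f * pr X a g);
  pairing_mu_lA : forall f X a, pr X (mu_l A f * a) = (fun g => f * pr X a g);
  pairing_mu_rU : forall f X a, pr (X * mu_r U f) a = (fun g => pr X a (f * g));
  pairing_mu_rA : forall f X a, pr X (a * mu_r A f) = (fun g => pr X a (f * g));
  pairing_mull : forall X Y a s, sweedler (Delta a) s ->
    pr (X * Y) a = (fun g => \sum_(t <- s)
      pr X (hleft t) (shiftM (hmid t) (pr Y (hright t) g)));
  pairing_mulr : forall X a b s, sweedler (Delta X) s ->
    pr X (a * b) = (fun g => \sum_(t <- s)
      pr (hleft t) a (shiftM (hmid t) (pr (hright t) b g)));
  pairing1r : forall X, pr X 1 = eps X;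
  pairing1l : forall a, pr 1 a = eps a }.

Definition is_hopf_pairing (SU : U -> U) (SA : A -> A) :=
  forall X a Q, fdo_antipode (pr X (SA a)) Q -> pr (SU X) a = Q.

Definition is_star_pairing cj (SA stA : A -> A) (stU : U -> U) :=
  forall ga de a X Q, hdeg ga de a -> fdo_star cj (pr X (stA (SA a))) Q ->
    pr (stU X) a = shiftM (- ga) \o Q \o shiftM (- de).

Definition is_dagger_pairing cj (SA stA : A -> A) (dgU : U -> U) :=
  forall ga de a X Q, hdeg ga de a -> fdo_star cj (pr X (SA (stA a))) Q ->
    pr (dgU X) a = shiftM (- ga) \o Q \o shiftM (- de).

(* lact X a is X.a and ract a X is a.X: linear in X, given for homogeneous X by
   the displayed formulas, whatever the homogeneous expression s of Delta a. *)
Definition is_left_act (lact : U -> A -> A) :=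
  (forall a, linear (lact^~ a)) /\
  forall al be X a s, hdeg al be X -> sweedler (Delta a) s ->
    lact X a = \sum_(t <- s) opr (hleft t) (pr X (hright t) \o shiftM be).

Definition is_right_act (ract : A -> U -> A) :=
  (forall a, linear (ract a)) /\
  forall al be X a s, hdeg al be X -> sweedler (Delta a) s ->
    ract a X = \sum_(t <- s) opl (shiftM al \o pr X (hleft t)) (hright t).
End Pairing.
End DynamicalAlgebras.

Arguments Delta {C h A} : rename.

(* Main.v *)
From HB Require Import structures.
From mathcomp Require Import all_boot all_order all_algebra.
From mathcomp Require Import complex.
From mathcomp Require Import boolp classical_sets functions.
From mathcomp Require Import reals topology normedtype derive.
Require Import Defs.

(** The sums defining X.a and a.X only involve the coproduct of a through forms in two
    variables that are bilinear and, on components with matching middle weight, balanced over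
    the meromorphic functions; any such form factors through the tensor product
    (tensor_lift). Hence the actions are well defined, and every identity can be checked on
    one Sweedler expansion that is adapted to the weights of a (sw). The main tool is coassoc:
    balanced forms in three variables have the same sum over both iterated coproducts.

    The pairing of homogeneous elements is a single term f T_{-w}, where f is its value at 1.
    With this, the action laws (lactM, ractM) and the commutation of the actions (lract_comm)
    say that two sums over a threefold coproduct agree, and the product rules (lact_mul,
    ract_mul) follow from the pairing rule for a product by moving a scalar across a factor
    of known weight.

    For the statements on antipodes and stars the structural properties of S have to be derived
    from its axioms. Each of them compares a left with a right convolution inverse by
    coassociativity: S is determined by its axioms (conv_unique), exchanges and negates
    weights (antipode_deg), is antimultiplicative (antipodeM), reverses the coproduct
    (Delta_antipode), and its composite with the star is an involution (antipode_starK). A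
    star negates and conjugates weights (star_deg) because the moment maps determine the
    grading (hdeg_moment). Then S(a.S(X)) = X.S(a) is a comparison of
    coefficients, and for both kinds of star pairing the remaining identities reduce to
    <Y, b> 1 = T_{-ga} bar(<X, b^*> 1) for b of left weight ga (lact_twist, ract_twist). *)

Set Implicit Arguments.
Unset Strict Implicit.
Unset Printing Implicit Defensive.

Import Order.TTheory GRing.Theory Num.Theory numFieldNormedType.Exports.
Import VectorInternalTheory.
Local Open Scope ring_scope.

(** * Translations and conjugation of meromorphic functions *)

Section MeroFacts.
Variables (C : numClosedFieldType) (V : vectType C).
Local Notation M := (mero V).
Implicit Types (f g : M) (a b : V).

Lemma to_mero_surj f : exists f' : mfun V, f = to_mero f'.
Proof. by exists (repr (f : {ideal_quot (@null_pred C V)})); rewrite /to_mero reprK. Qed.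

Lemma shiftM_zmod a : zmod_morphism (@shiftM C V a).
Proof.
move=> f g; have [f' ->] := to_mero_surj f; have [g' ->] := to_mero_surj g.
rewrite -rmorphB !shiftM_to_mero -rmorphB; congr to_mero; exact/val_inj.
Qed.

Lemma shiftM_monoid a : monoid_morphism (@shiftM C V a).
Proof.
split.
  by rewrite -(rmorph1 (@to_mero C V)) shiftM_to_mero; congr to_mero; exact/val_inj.
move=> f g; have [f' ->] := to_mero_surj f; have [g' ->] := to_mero_surj g.
rewrite -rmorphM !shiftM_to_mero -rmorphM; congr to_mero; exact/val_inj.
Qed.

HB.instance Definition _ a := GRing.isZmodMorphism.Build M M (shiftM a) (shiftM_zmod a).
HB.instance Definition _ a := GRing.isMonoidMorphism.Build M M (shiftM a) (shiftM_monoid a).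

Lemma shiftM_scalable a : scalable (@shiftM C V a).
Proof.
move=> c f; rewrite -[c *: f]/(to_mero (cst_mfun V c) * f) rmorphM /= shiftM_to_mero.
by congr (to_mero _ * _); exact/val_inj.
Qed.
HB.instance Definition _ a := GRing.isScalable.Build C M M _ (shiftM a) (shiftM_scalable a).

Lemma shiftM0 f : shiftM 0 f = f.
Proof.
have [f' ->] := to_mero_surj f; rewrite shiftM_to_mero; congr to_mero; apply/val_inj.
by apply/funext => l /=; rewrite addr0.
Qed.

Lemma shiftMD a b f : shiftM a (shiftM b f) = shiftM (a + b) f.
Proof.
have [f' ->] := to_mero_surj f; rewrite !shiftM_to_mero; congr to_mero; apply/val_inj.
by apply/funext => l /=; rewrite addrA.
Qed.

Section Bar.
Variable cj : conjugation V.

Lemma barM_zmod : zmod_morphism (@barM C V cj).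
Proof.
move=> f g; have [f' ->] := to_mero_surj f; have [g' ->] := to_mero_surj g.
rewrite -rmorphB !barM_to_mero -rmorphB; congr to_mero; apply/val_inj/funext => l /=.
exact: rmorphB.
Qed.

Lemma barM_monoid : monoid_morphism (@barM C V cj).
Proof.
split.
  rewrite -(rmorph1 (@to_mero C V)) barM_to_mero; congr to_mero; apply/val_inj/funext => l /=.
  exact: rmorph1.
move=> f g; have [f' ->] := to_mero_surj f; have [g' ->] := to_mero_surj g.
rewrite -rmorphM !barM_to_mero -rmorphM; congr to_mero; apply/val_inj/funext => l /=.
exact: rmorphM.
Qed.

HB.instance Definition _ := GRing.isZmodMorphism.Build M M (barM cj) barM_zmod.
HB.instance Definition _ := GRing.isMonoidMorphism.Build M M (barM cj) barM_monoid.

Lemma barMK : involutive (@barM C V cj).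
Proof.
move=> f; have [f' ->] := to_mero_surj f; rewrite !barM_to_mero; congr to_mero.
by apply/val_inj/funext => l /=; rewrite conj_involutive conjCK.
Qed.

Lemma conj_funD a b : cj (a + b) = cj a + cj b.
Proof. by have := conj_antilinear cj 1 a b; rewrite rmorph1 !scale1r. Qed.

Lemma conj_funN a : cj (- a) = - cj a.
Proof.
have z : cj 0 = 0.
  by have := conj_funD 0 0; rewrite addr0 -{1}[cj 0]addr0 => /addrI <-.
by apply/eqP; rewrite -addr_eq0 -conj_funD addNr z.
Qed.

Lemma barM_shift a f : barM cj (shiftM a f) = shiftM (cj a) (barM cj f).
Proof.
have [f' ->] := to_mero_surj f; rewrite !(barM_to_mero, shiftM_to_mero); congr to_mero.
by apply/val_inj/funext => l /=; rewrite conj_funD conj_involutive.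
Qed.
End Bar.
End MeroFacts.

Section LinearMero.
Variables (C : numClosedFieldType) (h : vectType C).
Local Notation hs := 'Hom(h, C^o).

Lemma meromorphic_eval (x : h) : meromorphic (fun l : hs => l x).
Proof.
move=> p; exists setT, (fun y => (r2v y : hs) x), (cst 1); split.
- by split => //; exact: openT.
- move=> y _; split; last exact: differentiable_cst.
  pose G (z : 'rV[C]_(dim hs)) : C := \sum_j (z 0 j * (r2v 'e_j : hs) x).
  rewrite (_ : (fun y => _) = G); last first.
    apply/funext => z; rewrite /G {1}[z]row_sum_delta linear_sum /= sum_lfunE.
    by apply: eq_bigr => j _; rewrite linearZ /= scale_lfunE.
  rewrite (_ : G = \sum_j (fun z : 'rV[C]_(dim hs) => z 0 j * (r2v 'e_j : hs) x)); last first.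
    by apply/funext => z; rewrite fct_sumE.
  apply: differentiable_sum => j; apply: differentiableM; last exact: differentiable_cst.
  exact: differentiable_coord.
- apply: genericT; first exact: openT.
  by move=> y _; rewrite oner_neq0 divr1.
Qed.

(** Evaluation at a vector x with al x <> be x works: its two translates differ by the
    constant al x - be x. Being a unit, this constant lets difference equations detect
    weights. *)
Lemma shiftM_separates (al be : hs) : al != be ->
  exists f : mero hs, exists2 c : C, c != 0 & shiftM al f - shiftM be f = c%:A.
Proof.
move=> ab; have [x xP] : exists x, al x != be x.
  apply: contrapT => H; move/eqP: ab; apply; apply/lfunP => x.
  by apply/eqP/negPn/negP => Hx; apply: H; exists x.
exists (to_mero (MFun (asboolT (meromorphic_eval x)))), (al x - be x).
  by rewrite subr_eq0.
rewrite !shiftM_to_mero -rmorphB -[RHS]/(to_mero (cst_mfun _ _) * 1) mulr1.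
congr to_mero; apply/val_inj/funext => l /=.
rewrite -[LHS]/((l + al) x - (l + be) x) !add_lfunE.
by rewrite opprD addrACA subrr add0r.
Qed.
End LinearMero.

(** * Linear maps out of a module given by generators and relations *)

Section PresentedLift.
Variables (K : comNzRingType) (W : choiceType) (rel : seq (K * W) -> Prop).
Variable N : lmodType K.
Implicit Types (psi : W -> N) (x : presented rel).

Definition fs_eval psi (s : seq (K * W)) : N := \sum_(p <- s) p.1 *: psi p.2.
(** Evaluated on a chosen representative, so that it is total and depends linearly on psi
    without any hypothesis; once psi kills the relations the choice does not matter. *)
Definition presented_lift psi x : N := fs_eval psi (of_presented x).

Lemma fs_eval_fs_eq psi s t : (forall s, rel s -> fs_eval psi s = 0) ->
  fs_eq rel s t -> fs_eval psi s = fs_eval psi t.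
Proof.
move=> psi0; rewrite /fs_eval; elim=> {s t} [//|//|s t u _ -> _ -> //|||||].
- by move=> s s' t t' _ IH _ IH'; rewrite !big_cat IH IH'.
- by move=> s t; rewrite !big_cat /= addrC.
- by move=> w; rewrite big_seq1 big_nil scale0r.
- by move=> c d w; rewrite !big_cons big_nil scalerDl !addr0.
- move=> c s /psi0 rs; rewrite /fs_scale big_map big_nil.
  transitivity (c *: fs_eval psi s); last by rewrite rs scaler0.
  by rewrite /fs_eval scaler_sumr; apply: eq_bigr => p _; rewrite scalerA.
Qed.

Lemma presented_liftE psi s : (forall s, rel s -> fs_eval psi s = 0) ->
  presented_lift psi (to_presented rel s) = fs_eval psi s.
Proof. by move=> psi0; apply: fs_eval_fs_eq => //; exact: to_presentedK. Qed.

Lemma presented_lift_linear psi : (forall s, rel s -> fs_eval psi s = 0) ->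
  linear (presented_lift psi).
Proof.
move=> psi0 c x y; rewrite -[x]of_presentedK -[y]of_presentedK.
rewrite -[c *: to_presented _ _]to_presentedZ -[_ + _]to_presentedD.
rewrite !presented_liftE // /fs_eval big_cat /= big_map scaler_sumr.
by congr (_ + _); apply: eq_bigr => p _; rewrite scalerA.
Qed.

Lemma presented_lift_combo c psi psi1 psi2 x :
  (forall w, psi w = c *: psi1 w + psi2 w) ->
  presented_lift psi x = c *: presented_lift psi1 x + presented_lift psi2 x.
Proof.
move=> psiE; rewrite /presented_lift /fs_eval scaler_sumr -big_split /=.
by apply: eq_bigr => p _; rewrite psiE scalerDr !scalerA mulrC.
Qed.

Lemma eq_presented_lift psi psi' x : psi =1 psi' ->
  presented_lift psi x = presented_lift psi' x.
Proof. by move=> e; apply: eq_bigr => p _; rewrite e. Qed.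

Lemma to_presentedE s :
  to_presented rel s = \sum_(p <- s) p.1 *: to_presented rel [:: (1, p.2)].
Proof.
elim: s => [|p s IH]; first by rewrite big_nil.
rewrite big_cons -IH -[_ *: _]to_presentedZ -[RHS]to_presentedD /=.
by rewrite mulr1; case: p.
Qed.
End PresentedLift.

(** * Homogeneous components *)

Section Grading.
Variables (C : numClosedFieldType) (h : vectType C).
Local Notation hs := 'Hom(h, C^o).
Local Notation M := (mero hs).
Variable A : hAlgebra h.
Implicit Types (a b : A) (al be ga de : hs) (d : hs * hs).

Lemma hdegD al be a b : hdeg al be a -> hdeg al be b -> hdeg al be (a + b).
Proof. by move=> da db; rewrite -[a]scale1r; exact: hdegP. Qed.

Lemma hdegZ al be c a : hdeg al be a -> hdeg al be (c *: a).
Proof. by move=> da; rewrite -[_ *: _]addr0; apply: hdegP => //; exact: hdeg0. Qed.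

Lemma hdeg_sum al be (I : Type) (r : seq I) (F : I -> A) :
  (forall i, hdeg al be (F i)) -> hdeg al be (\sum_(i <- r) F i).
Proof.
move=> dF; elim: r => [|i r IH]; first by rewrite big_nil; exact: hdeg0.
by rewrite big_cons; exact: hdegD.
Qed.

Lemma hdecomp a : exists (s : seq (hs * hs)) (c : hs * hs -> A),
  [/\ uniq s, forall d, hdeg d.1 d.2 (c d), forall d, d \notin s -> c d = 0
    & a = \sum_(d <- s) c d].
Proof.
have [s [c [dc ->]]] := hdeg_span a.
(* A weight may occur several times in s, always with the same component. *)
exists (undup s), (fun d => c d *+ count_mem d s); split.
- exact: undup_uniq.
- by move=> d; rewrite -scaler_nat; exact: hdegZ.
- by move=> d; rewrite mem_undup => /count_memPn ->; rewrite mulr0n.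
- rewrite -[LHS]big_undup_iterop_count; exact: eq_bigr.
Qed.

Definition hsupp a : seq (hs * hs) := sval (cid (hdecomp a)).
Definition hcomp a d : A := sval (cid (svalP (cid (hdecomp a)))) d.

Lemma hcompP a : [/\ uniq (hsupp a), forall d, hdeg d.1 d.2 (hcomp a d),
  forall d, d \notin hsupp a -> hcomp a d = 0 & a = \sum_(d <- hsupp a) hcomp a d].
Proof. exact: (svalP (cid (svalP (cid (hdecomp a))))). Qed.

Lemma hcomp_deg a d : hdeg d.1 d.2 (hcomp a d). Proof. by have [] := hcompP a. Qed.

Lemma sum_hsupp (N : zmodType) a (F : hs * hs -> A -> N) s :
  (forall d, F d 0 = 0) -> uniq s -> {subset hsupp a <= s} ->
  \sum_(d <- hsupp a) F d (hcomp a d) = \sum_(d <- s) F d (hcomp a d).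
Proof.
move=> F0 us sub; have [ua _ a0 _] := hcompP a.
rewrite [RHS](bigID (mem (hsupp a))) /= [X in _ + X]big1 ?addr0; last first.
  by move=> d /a0 ->.
rewrite -[RHS]big_filter; apply: perm_big; apply: uniq_perm => //; first exact: filter_uniq.
by move=> d; rewrite mem_filter andb_idr //; exact: sub.
Qed.

Lemma hcomp_uniq a s (c : hs * hs -> A) : (forall d, hdeg d.1 d.2 (c d)) ->
  (forall d, d \notin s -> c d = 0) -> uniq s -> a = \sum_(d <- s) c d ->
  forall d, hcomp a d = c d.
Proof.
move=> dc c0 us aE; pose r := undup (s ++ hsupp a).
have [ua da a0 aE'] := hcompP a.
have e1 : \sum_(d <- r) c d = a.
  rewrite aE [LHS](bigID (mem s)) /= [X in _ + X]big1 ?addr0; last by move=> d /c0.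
  rewrite -[LHS]big_filter; apply: perm_big; apply: uniq_perm => //.
    by apply: filter_uniq; exact: undup_uniq.
  by move=> d; rewrite mem_filter mem_undup mem_cat; case: (d \in s).
have e2 : \sum_(d <- r) hcomp a d = a.
  rewrite [RHS]aE'; apply/esym/(@sum_hsupp _ a (fun _ x => x)) => //.
    exact: undup_uniq.
  by move=> d dr; rewrite mem_undup mem_cat dr orbT.
move=> d; have [dr|/negP dr] := boolP (d \in r); last first.
  rewrite a0 ?c0 //; apply/negP => x; apply: dr; by rewrite mem_undup mem_cat x ?orbT.
apply/eqP; rewrite -subr_eq0; apply/eqP.
apply: (@hdeg_free _ _ A r (fun d => hcomp a d - c d)) => //.
- exact: undup_uniq.
- by move=> e; rewrite -scaleN1r addrC; exact: hdegP.
- by rewrite sumrB e2 e1 subrr.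
Qed.

Lemma hcomp_homog al be a : hdeg al be a ->
  forall d, hcomp a d = if d == (al, be) then a else 0.
Proof.
move=> da; apply: (@hcomp_uniq _ [:: (al, be)]) => //.
- by move=> d; case: eqP => [->|_] //; exact: hdeg0.
- by move=> d; rewrite inE => /negbTE ->.
- by rewrite big_seq1 eqxx.
Qed.

Lemma hcomp_linear d : linear (hcomp^~ d).
Proof.
move=> c a b; pose s := undup (hsupp a ++ hsupp b).
have [ua da a0 aE] := hcompP a; have [ub db b0 bE] := hcompP b.
apply: (@hcomp_uniq _ s (fun d => c *: hcomp a d + hcomp b d)).
- by move=> e; exact: hdegP.
- move=> e; rewrite mem_undup mem_cat negb_or => /andP[/a0 -> /b0 ->].
  by rewrite scaler0 addr0.
- exact: undup_uniq.
- rewrite big_split /= -scaler_sumr {1}aE {1}bE; congr (_ *: _ + _).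
    apply: (@sum_hsupp _ a (fun _ x => x)) => //; first exact: undup_uniq.
    by move=> e er; rewrite mem_undup mem_cat er.
  apply: (@sum_hsupp _ b (fun _ x => x)) => //; first exact: undup_uniq.
  by move=> e er; rewrite mem_undup mem_cat er orbT.
Qed.

Lemma homog_ext (N : zmodType) (F G : A -> N) :
  (forall a b, F (a + b) = F a + F b) -> (forall a b, G (a + b) = G a + G b) ->
  (forall al be a, hdeg al be a -> F a = G a) -> F =1 G.
Proof.
move=> FD GD FG a; have [_ da _ {1 2}->] := hcompP a.
have F0 : F 0 = 0 by have := FD 0 0; rewrite addr0 -{1}[F 0]addr0 => /addrI <-.
have G0 : G 0 = 0 by have := GD 0 0; rewrite addr0 -{1}[G 0]addr0 => /addrI <-.
rewrite (big_morph F FD F0) (big_morph G GD G0).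
by apply: eq_bigr => d _; apply: FG; exact: da.
Qed.

Section Hsum.
Variable N : lmodType C.
Implicit Types F G : hs -> hs -> A -> N.

(** Glues maps given on the single components A_{al,be} to a map on A. The weights are
    arguments of F because Sweedler formulas such as the one for <XY, a> involve T_rho, where
    rho is the weight of a factor. *)
Definition hsum F a := \sum_(d <- hsupp a) F d.1 d.2 (hcomp a d).

Let lin0 F : (forall al be, linear (F al be)) -> forall al be, F al be 0 = 0.
Proof. by move=> lF al be; have := lF al be (-1) 0 0; rewrite scaler0 addr0 scaleN1r addNr. Qed.

Lemma hsum_linear F : (forall al be, linear (F al be)) -> linear (hsum F).
Proof.
move=> lF c a b; pose s := undup (hsupp (c *: a + b) ++ hsupp a ++ hsupp b).
have F0 := lin0 lF.
have E x : {subset hsupp x <= s} -> hsum F x = \sum_(d <- s) F d.1 d.2 (hcomp x d).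
  move=> sx; apply: (@sum_hsupp _ x (fun d x => F d.1 d.2 x)) => //.
  exact: undup_uniq.
rewrite !E; first last.
- by move=> d dr; rewrite mem_undup mem_cat dr.
- by move=> d dr; rewrite mem_undup !mem_cat dr orbT.
- by move=> d dr; rewrite mem_undup !mem_cat dr !orbT.
rewrite scaler_sumr -big_split /=; apply: eq_bigr => d _.
by rewrite -lF hcomp_linear.
Qed.

Lemma hsum_homog F al be a : (forall al be, linear (F al be)) -> hdeg al be a ->
  hsum F a = F al be a.
Proof.
move=> lF da; have F0 := lin0 lF.
pose s := undup ((al, be) :: hsupp a).
rewrite /hsum (@sum_hsupp _ a (fun d x => F d.1 d.2 x) s) //; first last.
- by move=> d dr; rewrite mem_undup inE dr orbT.
- exact: undup_uniq.
rewrite (bigD1_seq (al, be)) ?undup_uniq ?mem_undup ?mem_head //=.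
rewrite (hcomp_homog da) eqxx big1 ?addr0 // => d /negbTE dn.
by rewrite (hcomp_homog da) dn.
Qed.

Lemma hsum_combo c F G H a :
  (forall al be x, F al be x = c *: G al be x + H al be x) ->
  hsum F a = c *: hsum G a + hsum H a.
Proof.
by move=> E; rewrite /hsum scaler_sumr -big_split /=; apply: eq_bigr => d _.
Qed.

Lemma eq_hsum F G a : (forall al be x, hdeg al be x -> F al be x = G al be x) ->
  hsum F a = hsum G a.
Proof. by move=> E; apply: eq_bigr => d _; apply: E; exact: hcomp_deg. Qed.
End Hsum.

Lemma hdeg_mu_lM f al be a : hdeg al be a -> hdeg al be (mu_l A f * a).
Proof. by move=> da; rewrite -[al]add0r -[be]add0r; apply: hdegM => //; exact: mu_l_deg. Qed.
Lemma hdeg_mu_rM f al be a : hdeg al be a -> hdeg al be (mu_r A f * a).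
Proof. by move=> da; rewrite -[al]add0r -[be]add0r; apply: hdegM => //; exact: mu_r_deg. Qed.

Lemma hdeg1 : hdeg 0 0 (1 : A).
Proof. by rewrite -(rmorph1 (mu_l A)); exact: mu_l_deg. Qed.

Lemma mulr_shift_l al be a f : hdeg al be a -> a * mu_l A f = mu_l A (shiftM (- al) f) * a.
Proof. by move=> da; rewrite (mu_l_shift _ da) shiftMD subrr shiftM0. Qed.
Lemma mulr_shift_r al be a f : hdeg al be a -> a * mu_r A f = mu_r A (shiftM (- be) f) * a.
Proof. by move=> da; rewrite (mu_r_shift _ da) shiftMD subrr shiftM0. Qed.

(** The moment maps determine the bigrading. If a commutes with mu_l like an element of left
    weight al, then a component of left weight al' is killed by mu_l (T_al' f - T_al f) for
    every f, and for al' <> al some such difference is a nonzero constant. *)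
Lemma hdeg_moment al be a :
  (forall f, mu_l A f * a = a * mu_l A (shiftM al f)) ->
  (forall f, mu_r A f * a = a * mu_r A (shiftM be f)) -> hdeg al be a.
Proof.
move=> la ra; have [us ds _ aE] := hcompP a.
have dcomp (mu : {lrmorphism M -> A}) (w : hs) (p : hs * hs -> hs) :
    (forall f, hdeg 0 0 (mu f)) ->
    (forall x f d, hdeg d.1 d.2 x -> mu f * x = x * mu (shiftM (p d) f)) ->
    (forall f, mu f * a = a * mu (shiftM w f)) ->
    forall d, p d != w -> d \in hsupp a -> hcomp a d = 0.
  move=> dm ms mw d pd din; have [f [c c0 fE]] := shiftM_separates pd.
  have e1 : mu f * a = \sum_(e <- hsupp a) hcomp a e * mu (shiftM (p e) f).
    by rewrite [in LHS]aE mulr_sumr; apply: eq_bigr => e _; exact: ms.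
  have e2 : a * mu (shiftM w f) = \sum_(e <- hsupp a) hcomp a e * mu (shiftM w f).
    by rewrite [in LHS]aE mulr_suml.
  have : hcomp a d * mu (shiftM (p d) f - shiftM w f) = 0.
    apply: (@hdeg_free _ _ A (hsupp a)
      (fun e => hcomp a e * mu (shiftM (p e) f - shiftM w f))) => //.
      by move=> e; rewrite -[e.1]addr0 -[e.2]addr0; apply: hdegM.
    rewrite -[RHS](subrr (mu f * a)) [X in _ = _ - X]mw e1 e2 -sumrB.
    by apply: eq_bigr => e _; rewrite rmorphB mulrBr.
  rewrite fE linearZ /= rmorph1 -scalerAr mulr1 => /eqP.
  by rewrite scaler_eq0 (negbTE c0) => /eqP.
have l0 := dcomp _ al fst (@mu_l_deg _ _ A) (fun x f d dx => mu_l_shift f dx) la.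
have r0 := dcomp _ be snd (@mu_r_deg _ _ A) (fun x f d dx => mu_r_shift f dx) ra.
rewrite aE big_seq; elim/big_ind: _ => [|x y|d din]; first exact: hdeg0.
  exact: hdegD.
have [d1|/l0 ->//] := eqVneq d.1 al; last exact: hdeg0.
have [d2|/r0 ->//] := eqVneq d.2 be; last exact: hdeg0.
by rewrite -d1 -d2.
Qed.

End Grading.

Section LinearMaps.
Variables (K : nzRingType) (V W : lmodType K) (F : V -> W).
Hypothesis linF : linear F.

Lemma linear_add : {morph F : v w / v + w}.
Proof. by move=> v w; have := linF 1 v w; rewrite !scale1r. Qed.

Lemma linear_zero : F 0 = 0.
Proof. by have := linear_add 0 0; rewrite addr0 -{1}[F 0]addr0 => /addrI <-. Qed.

Lemma linear_scale c v : F (c *: v) = c *: F v.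
Proof. by have := linF c v 0; rewrite linear_zero !addr0. Qed.

Lemma linear_sums (I : Type) (r : seq I) (P : pred I) (G : I -> V) :
  F (\sum_(i <- r | P i) G i) = \sum_(i <- r | P i) F (G i).
Proof. exact: (big_morph F linear_add linear_zero). Qed.
End LinearMaps.

(** * Linear maps out of the balanced tensor product *)

Section TensorLift.
Variables (C : numClosedFieldType) (h : vectType C).
Local Notation hs := 'Hom(h, C^o).
Variables A B : hAlgebra h.
Implicit Types (x y : tensor A B).

Lemma tens_linl (b : B) : linear (fun a : A => tens a b).
Proof.
move=> c a a'; apply/eqP; rewrite -subr_eq0 opprD addrA; apply/eqP.
transitivity (to_presented (@tensor_rel _ _ A B) [:: (1, (c *: a + a', b)); (- c, (a, b)); (- 1, (a', b))]).
  by rewrite to_presentedE !big_cons big_nil /= scale1r scaleN1r scaleNr addr0 addrA.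
apply/to_presentedP; rewrite -[X in fs_eq _ X]fs_scale1; apply: fs_rel; exact: tensor_linl.
Qed.

Lemma tens_linr (a : A) : linear (fun b : B => tens a b).
Proof.
move=> c b b'; apply/eqP; rewrite -subr_eq0 opprD addrA; apply/eqP.
transitivity (to_presented (@tensor_rel _ _ A B) [:: (1, (a, c *: b + b')); (- c, (a, b)); (- 1, (a, b'))]).
  by rewrite to_presentedE !big_cons big_nil /= scale1r scaleN1r scaleNr addr0 addrA.
apply/to_presentedP; rewrite -[X in fs_eq _ X]fs_scale1; apply: fs_rel; exact: tensor_linr.
Qed.

Lemma tens_bal f (a : A) (b : B) : tens (mu_r A f * a) b = tens a (mu_l B f * b).
Proof.
apply/eqP; rewrite -subr_eq0; apply/eqP.
transitivity (to_presented (@tensor_rel _ _ A B) [:: (1, (mu_r A f * a, b)); (- 1, (a, mu_l B f * b))]).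
  by rewrite to_presentedE !big_cons big_nil /= scale1r scaleN1r addr0.
apply/to_presentedP; rewrite -[X in fs_eq _ X]fs_scale1; apply: fs_rel; exact: tensor_bal.
Qed.

Lemma tens_off al ga ga' be (a : A) (b : B) : hdeg al ga a -> hdeg ga' be b ->
  ga != ga' -> tens a b = 0.
Proof.
move=> da db n; apply/to_presentedP; rewrite -[X in fs_eq _ X]fs_scale1; apply: fs_rel.
exact: tensor_off da db n.
Qed.

(** Expanding a and b in homogeneous components, the terms of a (x) b whose middle weights
    differ vanish and the others are terms of a Sweedler sum. *)
Lemma sweedler_of x : exists s, sweedler x s.
Proof.
have S0 : exists s, sweedler (0 : tensor A B) s by exists [::]; rewrite /sweedler big_nil.
have SD y z : (exists s, sweedler y s) -> (exists s, sweedler z s) ->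
    exists s, sweedler (y + z) s.
  by move=> [s ->] [t ->]; exists (s ++ t); rewrite /sweedler big_cat.
rewrite -[x]of_presentedK to_presentedE; elim/big_ind: _ => // -[c [a b]] _ /=.
rewrite -[to_presented _ _]/(tens a b).
have [_ da _ ->] := hcompP a; have [_ db _ ->] := hcompP b.
rewrite (linear_sums (tens_linl _)) scaler_sumr; elim/big_ind: _ => // d _.
rewrite (linear_sums (tens_linr _)) scaler_sumr; elim/big_ind: _ => // e _.
have [de|ne] := eqVneq d.2 e.1; last by rewrite (tens_off (da d) (db e) ne) scaler0.
have dl : exists al, hdeg al d.2 (c *: hcomp a d) by exists d.1; exact: hdegZ.
have dr : exists be, hdeg d.2 be (hcomp b e) by exists e.2; rewrite de.
exists [:: HTerm dl dr]; rewrite /sweedler big_seq1 /=.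
by rewrite (linear_scale (tens_linl _)).
Qed.

Section Lift.
Variable N : lmodType C.
Implicit Types phi : hs -> A -> B -> N.

(** The balance relation is required only where the weights match: the form defining the
    right action has it there and not in general, since moving mu_r f across a homogeneous
    element shifts f by its weight. *)
Record balanced phi : Prop := Balanced {
  bal_linl : forall ga b, linear (phi ga ^~ b);
  bal_linr : forall ga a, linear (phi ga a);
  bal_mu : forall f al ga be a b, hdeg al ga a -> hdeg ga be b ->
    phi ga (mu_r A f * a) b = phi ga a (mu_l B f * b) }.

(** The form phi on matching components, extended by zero to the others: this is what the
    relation tensor_off forces. *)
Definition extend_by_zero phi (p : A * B) : N :=
  hsum (fun _ ga a => hsum (fun ga' _ b => if ga == ga' then phi ga a b else 0) p.2) p.1.

Definition tensor_lift phi x : N := presented_lift (extend_by_zero phi) x.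

Lemma extend_by_zero_combo c phi phi1 phi2 p :
  (forall ga a b, phi ga a b = c *: phi1 ga a b + phi2 ga a b) ->
  extend_by_zero phi p = c *: extend_by_zero phi1 p + extend_by_zero phi2 p.
Proof.
move=> E; apply: hsum_combo => _ ga a; apply: hsum_combo => ga' _ b.
by case: eqP; rewrite ?E ?scaler0 ?addr0.
Qed.

Lemma tensor_lift_combo c phi phi1 phi2 x :
  (forall ga a b, phi ga a b = c *: phi1 ga a b + phi2 ga a b) ->
  tensor_lift phi x = c *: tensor_lift phi1 x + tensor_lift phi2 x.
Proof. by move=> E; apply: presented_lift_combo => p; exact: extend_by_zero_combo. Qed.

Lemma eq_tensor_lift phi phi' x :
  (forall al ga be a b, hdeg al ga a -> hdeg ga be b -> phi ga a b = phi' ga a b) ->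
  tensor_lift phi x = tensor_lift phi' x.
Proof.
move=> E; apply: eq_presented_lift => p; apply: eq_hsum => al ga a da.
by apply: eq_hsum => ga' be b; case: eqP => // <- db; exact: E da db.
Qed.

Section LiftBalanced.
Variable phi : hs -> A -> B -> N.
Hypothesis bphi : balanced phi.

Let lin2 ga a : forall ga' be : hs, linear (fun b => if ga == ga' then phi ga a b else 0).
Proof.
move=> ga' be c b b'; case: eqP => _; first exact: bal_linr.
by rewrite scaler0 addr0.
Qed.

Let lin1 b : forall al ga : hs, linear (fun a =>
  hsum (fun ga' _ b => if ga == ga' then phi ga a b else 0) b).
Proof.
move=> al ga c a a'; apply: hsum_combo => ga' be b'; case: eqP => _.
  exact: bal_linl.
by rewrite scaler0 addr0.
Qed.

Lemma extend_by_zero_linl b : linear (fun a => extend_by_zero phi (a, b)).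
Proof. exact: (hsum_linear (@lin1 b)). Qed.

Lemma extend_by_zero_linr a : linear (fun b => extend_by_zero phi (a, b)).
Proof.
move=> c b b'; apply: hsum_combo => al ga a'.
exact: (hsum_linear (@lin2 ga a')).
Qed.

Lemma extend_by_zero_homog al ga ga' be a b : hdeg al ga a -> hdeg ga' be b ->
  extend_by_zero phi (a, b) = if ga == ga' then phi ga a b else 0.
Proof.
move=> da db; rewrite /extend_by_zero /= (hsum_homog (@lin1 b) da).
by rewrite (hsum_homog (@lin2 ga a) db).
Qed.

Lemma tensor_rel0 s : tensor_rel s -> fs_eval (extend_by_zero phi) s = 0.
Proof.
case=> {s} [c a a' b|c a b b'|f a b|al ga ga' be a b da db ne]; rewrite /fs_eval !big_cons big_nil /=.
- rewrite (extend_by_zero_linl b c a a') !scale1r scaleN1r scaleNr addr0.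
  by rewrite -opprD subrr.
- rewrite (extend_by_zero_linr a c b b') !scale1r scaleN1r scaleNr addr0.
  by rewrite -opprD subrr.
- rewrite scale1r scaleN1r addr0; apply/eqP; rewrite subr_eq0; apply/eqP.
  move: a; apply: homog_ext => [a a'|a a'|al ga a da].
  + by rewrite mulrDr (linear_add (extend_by_zero_linl b)).
  + exact: (linear_add (extend_by_zero_linl _)).
  move: b; apply: homog_ext => [b b'|b b'|ga' be b db].
  + exact: (linear_add (extend_by_zero_linr _)).
  + by rewrite mulrDr (linear_add (extend_by_zero_linr _)).
  rewrite (extend_by_zero_homog (hdeg_mu_rM f da) db) (extend_by_zero_homog da (hdeg_mu_lM f db)).
  by case: eqP db => // <- db; exact: bal_mu da db.
- by rewrite (extend_by_zero_homog da db) (negbTE ne) scaler0 addr0.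
Qed.

Lemma tensor_lift_linear : linear (tensor_lift phi).
Proof. exact: (presented_lift_linear tensor_rel0). Qed.

Lemma tensor_lift_sum (I : Type) (r : seq I) (F : I -> tensor A B) :
  tensor_lift phi (\sum_(i <- r) F i) = \sum_(i <- r) tensor_lift phi (F i).
Proof.
exact: (linear_sums tensor_lift_linear).
Qed.

Lemma tensor_lift_tens al ga be a b : hdeg al ga a -> hdeg ga be b ->
  tensor_lift phi (tens a b) = phi ga a b.
Proof.
move=> da db; rewrite /tensor_lift /tens presented_liftE; last exact: tensor_rel0.
by rewrite /fs_eval big_seq1 scale1r (extend_by_zero_homog da db) eqxx.
Qed.

Lemma tensor_lift_sweedler x s : sweedler x s ->
  tensor_lift phi x = \sum_(t <- s) phi (hmid t) (hleft t) (hright t).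
Proof.
move=> ->; rewrite tensor_lift_sum; apply: eq_bigr => t _.
by have [al da] := hleft_deg t; have [be db] := hright_deg t; exact: tensor_lift_tens da db.
Qed.
End LiftBalanced.
End Lift.
End TensorLift.

(** * Sweedler expansions and coassociativity *)

Section Sweedler.
Variables (C : numClosedFieldType) (h : vectType C).
Local Notation hs := 'Hom(h, C^o).
Variable A : hBialgebroid h.
Implicit Types (a b : A).

(** One expansion of the coproduct of a that is adapted to every weight of a. It is indexed
    by ordinals, so that facts about all of its terms can be used under a sum. *)
Lemma adapted_sweedler_of a : exists n (t : 'I_n -> hterm A A),
  Delta a = \sum_i tens (hleft (t i)) (hright (t i)) /\
  forall al be, hdeg al be a ->
    forall i, hdeg al (hmid (t i)) (hleft (t i)) /\ hdeg (hmid (t i)) be (hright (t i)).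
Proof.
(* 0 has all weights at once, which the empty expansion fits. *)
have [a0|a0] := eqVneq a 0.
  exists 0%N, (fun i : 'I_0 => match i with Ordinal _ p => False_rect _ (notF p) end).
  by rewrite a0 linear0 big_ord0; split=> // al be _ [].
have [[al [be da]]|nd] := pselect (exists al be, hdeg al be a).
  have [n [ga [x [y [dxy E]]]]] := Delta_deg da.
  exists n, (fun i => HTerm (ex_intro _ al (dxy i).1) (ex_intro _ be (dxy i).2)).
  split=> // al' be' da'.
  have := hcomp_homog da (al', be'); rewrite (hcomp_homog da') eqxx.
  case: eqP => [[-> ->] _ //|_ /eqP]; by rewrite (negbTE a0).
have [s sP] := sweedler_of (Delta a).
exists (size s), (tnth (in_tuple s)); split; first by rewrite sP big_tnth.
by move=> al be da; case: nd; exists al, be.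
Qed.

Definition sw_size a : nat := sval (cid (adapted_sweedler_of a)).
Definition sw a : 'I_(sw_size a) -> hterm A A :=
  sval (cid (svalP (cid (adapted_sweedler_of a)))).
Arguments sw : clear implicits.

Definition sw_seq a : seq (hterm A A) := [seq sw a i | i <- enum 'I_(sw_size a)].

Lemma sw_seqP a : sweedler (Delta a) (sw_seq a).
Proof.
have [+ _] := svalP (cid (svalP (cid (adapted_sweedler_of a)))).
by rewrite /sweedler /sw_seq big_map big_enum /= => ->.
Qed.

Local Notation lft a i := (hleft (sw a i)).
Local Notation rgt a i := (hright (sw a i)).
Local Notation mid a i := (hmid (sw a i)).

Lemma sum_sw (N : nmodType) a (F : hterm A A -> N) :
  \sum_(t <- sw_seq a) F t = \sum_(i < sw_size a) F (sw a i).
Proof. by rewrite /sw_seq big_map big_enum. Qed.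

Lemma DeltaE a : Delta a = \sum_(i < sw_size a) tens (lft a i) (rgt a i).
Proof. by rewrite -(sum_sw _ (fun t => tens (hleft t) (hright t))); exact: sw_seqP. Qed.

Lemma sw_deg al be a : hdeg al be a ->
  forall i, hdeg al (mid a i) (lft a i) /\ hdeg (mid a i) be (rgt a i).
Proof. by have [_] := svalP (cid (svalP (cid (adapted_sweedler_of a)))); apply. Qed.

(** Sweedler notation is sound: the sum does not depend on the expansion. *)
Lemma sw_indep (N : lmodType C) (phi : hs -> A -> A -> N) a s : balanced phi ->
  sweedler (Delta a) s ->
  \sum_(i < sw_size a) phi (mid a i) (lft a i) (rgt a i) =
  \sum_(t <- s) phi (hmid t) (hleft t) (hright t).
Proof.
move=> bphi sP; rewrite -(tensor_lift_sweedler bphi sP) (tensor_lift_sweedler bphi (sw_seqP a)).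
by rewrite (sum_sw _ (fun t => phi (hmid t) (hleft t) (hright t))).
Qed.

Section Coassoc.
Variables (N : lmodType C) (al0 be0 : hs) (phi : hs -> hs -> A -> A -> A -> N).

(** The outer weights al0 and be0 are fixed because balance may depend on them: the form
    (x, y, z) |-> c S(z) (x) x S(y) is balanced when the left weight of x is the right weight
    of c. *)
Record balanced3 : Prop := Balanced3 {
  bal3_lin1 : forall r s y z, linear (fun x => phi r s x y z);
  bal3_lin2 : forall r s x z, linear (fun y => phi r s x y z);
  bal3_lin3 : forall r s x y, linear (fun z => phi r s x y z);
  bal3_mu12 : forall f r s x y z, hdeg al0 r x -> hdeg r s y -> hdeg s be0 z ->
    phi r s (mu_r A f * x) y z = phi r s x (mu_l A f * y) z;
  bal3_mu23 : forall f r s x y z, hdeg al0 r x -> hdeg r s y -> hdeg s be0 z ->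
    phi r s x (mu_r A f * y) z = phi r s x y (mu_l A f * z) }.
Hypothesis bphi : balanced3.

Definition extend_by_zero3 (p : A * A * A) : N :=
  hsum (fun al r x => hsum (fun r' s y => hsum (fun s' be z =>
    if [&& al == al0, r == r', s == s' & be == be0] then phi r s x y z else 0)
    p.2) p.1.2) p.1.1.

Let lin3 al r s r' x y : forall s' be : hs, linear (fun z =>
  if [&& al == al0, r == r', s == s' & be == be0] then phi r s x y z else 0).
Proof.
move=> s' be c z z'; case: ifP => _; first exact: bal3_lin3.
by rewrite scaler0 addr0.
Qed.

Let lin2 (al : hs) r x z : forall r' s : hs, linear (fun y => hsum (fun s' be z =>
  if [&& al == al0, r == r', s == s' & be == be0] then phi r s x y z else 0) z).
Proof.
move=> r' s c y y'; apply: hsum_combo => s' be z'; case: ifP => _.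
  exact: bal3_lin2.
by rewrite scaler0 addr0.
Qed.

Let lin1 y z : forall al r : hs, linear (fun x => hsum (fun r' s y => hsum (fun s' be z =>
  if [&& al == al0, r == r', s == s' & be == be0] then phi r s x y z else 0) z) y).
Proof.
move=> al r c x x'; do 2!apply: hsum_combo => ? ? ?; case: ifP => _.
  exact: bal3_lin1.
by rewrite scaler0 addr0.
Qed.

Lemma extend_by_zero3_lin1 y z : linear (fun x => extend_by_zero3 (x, y, z)).
Proof. exact: (hsum_linear (@lin1 y z)). Qed.

Lemma extend_by_zero3_lin2 x z : linear (fun y => extend_by_zero3 (x, y, z)).
Proof.
move=> c y y'; apply: hsum_combo => al r x'; exact: (hsum_linear (@lin2 al r x' z)).
Qed.

Lemma extend_by_zero3_lin3 x y : linear (fun z => extend_by_zero3 (x, y, z)).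
Proof.
move=> c z z'; do 2!apply: hsum_combo => ? ? ?; exact: (hsum_linear (@lin3 _ _ _ _ _ _)).
Qed.

Lemma extend_by_zero3_homog al r r' s s' be x y z : hdeg al r x -> hdeg r' s y -> hdeg s' be z ->
  extend_by_zero3 (x, y, z) =
  if [&& al == al0, r == r', s == s' & be == be0] then phi r s x y z else 0.
Proof.
move=> dx dy dz; rewrite /extend_by_zero3 /= (hsum_homog (@lin1 y z) dx).
by rewrite (hsum_homog (@lin2 al r x z) dy) (hsum_homog (@lin3 _ _ _ _ _ _) dz).
Qed.

Lemma tensor3_rel0 s : tensor3_rel s -> fs_eval extend_by_zero3 s = 0.
Proof.
have lin_eq c (u v : N) : 1 *: (c *: u + v) + (- c *: u + (-1 *: v + 0)) = 0.
  by rewrite !scale1r scaleN1r scaleNr addr0 -opprD subrr.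
case=> {s} [c a a' b d|c a b b' d|c a b d d'|f a b d|f a b d|al ga ga' be a b d da db ne
  |al ga ga' be a b d db dd ne]; rewrite /fs_eval !big_cons big_nil /=.
- by rewrite (extend_by_zero3_lin1 b d c a a').
- by rewrite (extend_by_zero3_lin2 a d c b b').
- by rewrite (extend_by_zero3_lin3 a b c d d').
- rewrite scale1r scaleN1r addr0; apply/eqP; rewrite subr_eq0; apply/eqP.
  move: a; apply: homog_ext => [a a'|a a'|al r a da].
  + by rewrite mulrDr (linear_add (extend_by_zero3_lin1 _ _)).
  + exact: (linear_add (extend_by_zero3_lin1 _ _)).
  move: b; apply: homog_ext => [b b'|b b'|r' s b db].
  + exact: (linear_add (extend_by_zero3_lin2 _ _)).
  + by rewrite mulrDr (linear_add (extend_by_zero3_lin2 _ _)).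
  move: d; apply: homog_ext => [d d'|d d'|s' be d dd].
  + exact: (linear_add (extend_by_zero3_lin3 _ _)).
  + exact: (linear_add (extend_by_zero3_lin3 _ _)).
  rewrite (extend_by_zero3_homog (hdeg_mu_rM f da) db dd) (extend_by_zero3_homog da (hdeg_mu_lM f db) dd).
  by case: and4P => // -[/eqP ? /eqP ? /eqP ? /eqP ?]; subst; exact: bal3_mu12 da db dd.
- rewrite scale1r scaleN1r addr0; apply/eqP; rewrite subr_eq0; apply/eqP.
  move: a; apply: homog_ext => [a a'|a a'|al r a da].
  + exact: (linear_add (extend_by_zero3_lin1 _ _)).
  + exact: (linear_add (extend_by_zero3_lin1 _ _)).
  move: b; apply: homog_ext => [b b'|b b'|r' s b db].
  + by rewrite mulrDr (linear_add (extend_by_zero3_lin2 _ _)).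
  + exact: (linear_add (extend_by_zero3_lin2 _ _)).
  move: d; apply: homog_ext => [d d'|d d'|s' be d dd].
  + exact: (linear_add (extend_by_zero3_lin3 _ _)).
  + by rewrite mulrDr (linear_add (extend_by_zero3_lin3 _ _)).
  rewrite (extend_by_zero3_homog da (hdeg_mu_rM f db) dd) (extend_by_zero3_homog da db (hdeg_mu_lM f dd)).
  by case: and4P => // -[/eqP ? /eqP ? /eqP ? /eqP ?]; subst; exact: bal3_mu23 da db dd.
- rewrite (_ : extend_by_zero3 (a, b, d) = 0) ?scaler0 ?addr0 //.
  move: d; apply: (homog_ext (G := fun=> 0)) => [d d'|d d'|s' be' d dd].
  + exact: (linear_add (extend_by_zero3_lin3 _ _)).
  + by rewrite addr0.
  by rewrite (extend_by_zero3_homog da db dd) (negbTE ne) andbF.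
- rewrite (_ : extend_by_zero3 (a, b, d) = 0) ?scaler0 ?addr0 //.
  move: a; apply: (homog_ext (G := fun=> 0)) => [a a'|a a'|al' r a da].
  + exact: (linear_add (extend_by_zero3_lin1 _ _)).
  + by rewrite addr0.
  by rewrite (extend_by_zero3_homog da db dd) (negbTE ne) !andbF.
Qed.

Definition tensor3_lift (x : tensor3 A) : N := presented_lift extend_by_zero3 x.

Lemma tensor3_lift_sum (I : Type) (r : seq I) (F : I -> tensor3 A) :
  tensor3_lift (\sum_(i <- r) F i) = \sum_(i <- r) tensor3_lift (F i).
Proof.
exact: (linear_sums (presented_lift_linear tensor3_rel0)).
Qed.

Lemma tensor3_lift_tens r s x y z : hdeg al0 r x -> hdeg r s y -> hdeg s be0 z ->
  tensor3_lift (tens3 x y z) = phi r s x y z.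
Proof.
move=> dx dy dz; rewrite /tensor3_lift /tens3 presented_liftE; last exact: tensor3_rel0.
by rewrite /fs_eval big_seq1 scale1r (extend_by_zero3_homog dx dy dz) !eqxx.
Qed.

(** The inner expansions are adapted to the factors they expand, so the middle weights of
    the threefold terms match and the lift of phi to the threefold tensor product takes them
    to values of phi. *)
Lemma coassoc a : hdeg al0 be0 a ->
  \sum_(i < sw_size a) \sum_(j < sw_size (lft a i))
    phi (mid (lft a i) j) (mid a i) (lft (lft a i) j) (rgt (lft a i) j) (rgt a i) =
  \sum_(i < sw_size a) \sum_(j < sw_size (rgt a i))
    phi (mid a i) (mid (rgt a i) j) (lft a i) (lft (rgt a i) j) (rgt (rgt a i) j).
Proof.
move=> da.
have := @DeltaA _ _ _ a (sw_seq a) (fun t => sw_seq (hleft t)) (fun t => sw_seq (hright t))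
  (sw_seqP a) (fun t => sw_seqP _) (fun t => sw_seqP _).
rewrite !sum_sw => /(congr1 tensor3_lift); rewrite !tensor3_lift_sum => E.
etransitivity; last (etransitivity; first exact: E).
  apply: eq_bigr => i _; rewrite sum_sw tensor3_lift_sum; apply: eq_bigr => j _.
  have [dl dr] := sw_deg da i; have [dll dlr] := sw_deg dl j.
  exact/esym/(tensor3_lift_tens dll dlr dr).
apply: eq_bigr => i _; rewrite sum_sw tensor3_lift_sum; apply: eq_bigr => j _.
have [dl dr] := sw_deg da i; have [drl drr] := sw_deg dr j.
exact: (tensor3_lift_tens dl drl drr).
Qed.
End Coassoc.
End Sweedler.

Arguments sw_size {C h A} a.
Arguments sw {C h A} a i.
Arguments sw_seq {C h A} a.
Notation lft a i := (hleft (sw a i)).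
Notation rgt a i := (hright (sw a i)).
Notation mid a i := (hmid (sw a i)).

(** Multilinearity of a product of linear expressions. *)
Ltac solve_linear := let c := fresh "c" in let u := fresh "u" in let v := fresh "v" in
  move=> c u v;
  rewrite /= ?(mulrDl, mulrDr, =^~ scalerAl, =^~ scalerAr, linearD, linearZ_LR) //=.

(** * The antipode reverses weights and products *)

Section Bialgebroid.
Variables (C : numClosedFieldType) (h : vectType C).
Local Notation hs := 'Hom(h, C^o).
Variable A : hBialgebroid h.
Implicit Types (a b : A).

Lemma eps_shiftE al be a g : hdeg al be a -> eps a g = eps a 1 * shiftM (- al) g.
Proof.
move=> /(@eps_deg _ _ A); rewrite /fdo_deg; case: eqP => [_ [f ->]|_ ->]; last by rewrite mul0r.
by rewrite rmorph1 mulr1.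
Qed.

Lemma eps_off al be a : hdeg al be a -> al != be -> eps a 1 = 0.
Proof. by move=> /(@eps_deg _ _ A) /[swap]; rewrite /fdo_deg => /negbTE -> ->. Qed.

(** Where the two weights of a differ, eps a vanishes. *)
Lemma eps_shift_eq al be a : hdeg al be a -> shiftM al (eps a 1) = shiftM be (eps a 1).
Proof.
move=> da; have [->//|ne] := eqVneq al be.
by rewrite (eps_off da ne) !rmorph0.
Qed.

Lemma counit_l a : \sum_(i < sw_size a) mu_l A (eps (lft a i) 1) * rgt a i = a.
Proof. by rewrite -[RHS](eps_left (sw_seqP a)) sum_sw. Qed.

Lemma counit_r a : \sum_(i < sw_size a) mu_r A (eps (rgt a i) 1) * lft a i = a.
Proof. by rewrite -[RHS](eps_right (sw_seqP a)) sum_sw. Qed.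

Section HtermMul.
Variables u v : hterm A A.
Fact hterm_mul_l : exists al, hdeg al (hmid u + hmid v) (hleft u * hleft v).
Proof.
have [al du] := hleft_deg u; have [be dv] := hleft_deg v.
by exists (al + be); exact: hdegM.
Qed.
Fact hterm_mul_r : exists be, hdeg (hmid u + hmid v) be (hright u * hright v).
Proof.
have [al du] := hright_deg u; have [be dv] := hright_deg v.
by exists (al + be); exact: hdegM.
Qed.
Definition hterm_mul := HTerm hterm_mul_l hterm_mul_r.
End HtermMul.

Lemma sweedler_mul a b s t : sweedler (Delta a) s -> sweedler (Delta b) t ->
  sweedler (Delta (a * b)) [seq hterm_mul u v | u <- s, v <- t].
Proof.
move=> sa tb; rewrite /sweedler (DeltaM sa tb).
by rewrite big_allpairs_dep /=.
Qed.

Lemma hcomp_mull al be a b ga de : hdeg al be a ->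
  hcomp (a * b) (al + ga, be + de) = a * hcomp b (ga, de).
Proof.
move=> da; move: b; apply: homog_ext => [b b'|b b'|ga' de' b db].
- by rewrite mulrDr (linear_add (hcomp_linear _)).
- by rewrite (linear_add (hcomp_linear _)) mulrDr.
rewrite (hcomp_homog (hdegM da db)) (hcomp_homog db) !xpair_eqE.
by rewrite !(can_eq (addKr _)) (fun_if (fun x => a * x)) mulr0.
Qed.
End Bialgebroid.

Section Antipode.
Variables (C : numClosedFieldType) (h : vectType C).
Local Notation hs := 'Hom(h, C^o).
Variable A : hBialgebroid h.
Implicit Types (a b : A).

(** A left and a right convolution inverse of the identity agree: evaluate
    \sum S(a_1) a_2 S'(a_3) with both bracketings. *)
Lemma conv_unique (S S' : {linear A -> A}) :
  (forall f a, S (mu_r A f * a) = S a * mu_l A f) ->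
  (forall al be a, hdeg al be a ->
     \sum_(i < sw_size a) S (lft a i) * rgt a i = mu_r A (shiftM al (eps a 1))) ->
  (forall f a, S' (a * mu_l A f) = mu_r A f * S' a) ->
  (forall al be a, hdeg al be a ->
     \sum_(i < sw_size a) lft a i * S' (rgt a i) = mu_l A (eps a 1)) ->
  S =1 S'.
Proof.
move=> Sr SL S'l S'R; apply: homog_ext => [a b|a b|al be a da]; [exact: linearD..|].
have S'l' r s z f : hdeg r s z -> S' (mu_l A f * z) = mu_r A (shiftM r f) * S' z.
  by move=> dz; rewrite (mu_l_shift _ dz) S'l.
have bal : balanced3 al be (fun _ _ x y z => S x * y * S' z).
  split=> [r s y z|r s x z|r s x y|f r s x y z dx dy dz|f r s x y z dx dy dz].
  - by solve_linear.
  - by solve_linear.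
  - by solve_linear.
  - by rewrite Sr !mulrA.
  - by rewrite (mu_r_shift _ dy) (S'l' _ _ _ _ dz) !mulrA.
have := coassoc bal da.
under eq_bigr => i _ do [have [dl dr] := sw_deg da i;
  rewrite -mulr_suml (SL _ _ _ dl) (eps_shift_eq dl) -(S'l' _ _ _ _ dr)].
rewrite -linear_sum counit_l => ->.
under eq_bigr => i _ do [have [dl dr] := sw_deg da i].
transitivity (S (\sum_(i < sw_size a) mu_r A (eps (rgt a i) 1) * lft a i)).
  by rewrite counit_r.
rewrite linear_sum; apply: eq_bigr => i _; have [dl dr] := sw_deg da i.
under eq_bigr do rewrite -mulrA.
by rewrite -mulr_sumr (S'R _ _ _ dr) Sr.
Qed.

Variable S : {linear A -> A}.
Hypothesis SA : is_antipode S.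

Lemma antipode_l al be a : hdeg al be a ->
  \sum_(i < sw_size a) S (lft a i) * rgt a i = mu_r A (shiftM al (eps a 1)).
Proof. by move=> da; rewrite -(antipode_left SA da (sw_seqP a)) sum_sw. Qed.

Lemma antipode_r a : \sum_(i < sw_size a) lft a i * S (rgt a i) = mu_l A (eps a 1).
Proof. by rewrite -(antipode_right SA (sw_seqP a)) sum_sw. Qed.

Lemma antipode_mu_lM r s z f : hdeg r s z ->
  S (mu_l A f * z) = mu_r A (shiftM r f) * S z.
Proof. by move=> dz; rewrite (mu_l_shift _ dz) antipode_mu_l. Qed.

Lemma antipode1 : S 1 = 1.
Proof.
have /(antipode_right SA) : sweedler (Delta (1 : A))
    [:: HTerm (ex_intro _ 0 (@hdeg1 _ _ A)) (ex_intro _ 0 (@hdeg1 _ _ A))].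
  by rewrite /sweedler big_seq1 Delta1.
by rewrite big_seq1 /= mul1r eps1 rmorph1.
Qed.

Lemma antipode_mu_rE f : S (mu_r A f) = mu_l A f.
Proof. by rewrite -[mu_r A f]mulr1 antipode_mu_r // antipode1 mul1r. Qed.

Lemma antipode_mu_lE f : S (mu_l A f) = mu_r A f.
Proof. by rewrite -[mu_l A f]mul1r antipode_mu_l // antipode1 mulr1. Qed.

(** The part of S of the expected bidegree. The axioms of an antipode give only one-sided
    rules for the moment maps, so the weights of S a cannot be read off them. *)
Definition antipode_trunc a : A := hsum (fun al be x => hcomp (S x) (- be, - al)) a.

Lemma antipode_component_linear (al be : hs) : linear (fun x => hcomp (S x) (- be, - al)).
Proof. by move=> c x y; rewrite linearP hcomp_linear. Qed.

Lemma antipode_trunc_linear : linear antipode_trunc.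
Proof. exact: (hsum_linear antipode_component_linear). Qed.
HB.instance Definition _ := GRing.isLinear.Build C A A _ antipode_trunc antipode_trunc_linear.

Lemma antipode_truncE al be a : hdeg al be a ->
  antipode_trunc a = hcomp (S a) (- be, - al).
Proof. exact: (hsum_homog antipode_component_linear). Qed.

(** For a of weights al and be, truncating S cuts \sum a_1 S(a_2) down to its component of
    bidegree (al - be, 0). The sum is mu_l (eps a 1), which is zero unless al = be, so nothing
    is lost: the truncation is again a right convolution inverse of the identity, and equals
    S by uniqueness. *)
Lemma antipode_deg al be a : hdeg al be a -> hdeg (- be) (- al) (S a).
Proof.
suff -> : S a = antipode_trunc a by move=> /antipode_truncE ->; exact: (hcomp_deg _ (- be, - al)).
move: al be a => _ _; apply: conv_unique.
- exact: antipode_mu_r.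
- exact: antipode_l.
- move=> f; apply: homog_ext => [a b|a b|al be a da].
  + by rewrite mulrDl linearD.
  + by rewrite linearD /= mulrDr.
  rewrite /= (antipode_truncE da) (mulr_shift_l _ da) (antipode_truncE (hdeg_mu_lM _ da)).
  rewrite -(mulr_shift_l _ da) antipode_mu_l //.
  by rewrite -[- be]add0r -[- al]add0r (hcomp_mull _ _ _ (mu_r_deg A f)) !add0r.
- move=> al be a da; have e0 := eps_off da.
  transitivity (hcomp (mu_l A (eps a 1)) (al - be, 0)).
    rewrite -antipode_r (linear_sums (hcomp_linear _)); apply: eq_bigr => i _.
    have [dl dr] := sw_deg da i.
    by rewrite /= (antipode_truncE dr) -(hcomp_mull _ _ _ dl) subrr.
  rewrite (hcomp_homog (mu_l_deg _ _)) xpair_eqE eqxx andbT subr_eq0.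
  by case: eqP => // /eqP/e0 ->; rewrite rmorph0.
Qed.

(** Evaluate \sum S(a_1 b_1) a_2 b_2 S(b_3) S(a_3) in two ways. Contracting b_2 S(b_3) and
    then a_2 S(a_3) gives S(ab), contracting S(a_1 b_1) a_2 b_2 gives S(b) S(a). The
    contractions leave values of the counit, which are carried to the factor that they
    belong to by the moment maps; for this the weights of S b are needed. *)
Lemma antipodeM a b : S (a * b) = S b * S a.
Proof.
move: a; apply: homog_ext => [a a'|a a'|al be a da].
- by rewrite mulrDl linearD.
- by rewrite linearD /= mulrDr.
move: b; apply: homog_ext => [b b'|b b'|al' be' b db].
- by rewrite mulrDr linearD.
- by rewrite linearD /= mulrDl.
have balA p e : balanced3 al be (fun _ _ x y z => S (x * p) * y * mu_l A e * S z).
  split=> [r s y z|r s x z|r s x y|f r s x y z dx dy dz|f r s x y z dx dy dz].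
  - by solve_linear.
  - by solve_linear.
  - by solve_linear.
  - by rewrite -[mu_r A f * x * p]mulrA antipode_mu_r // !mulrA.
  - rewrite (antipode_mu_lM _ dz) (mu_r_shift _ dy) -!mulrA; do 2 congr (_ * _).
    by rewrite !mulrA mu_lrC.
have balB al0 r be0 x y z : hdeg al0 r x -> hdeg r be0 y ->
    balanced3 al' be' (fun _ _ p q w => S (x * p) * y * q * S w * S z).
  move=> dx dy; split=> [r0 s y0 z0|r0 s x0 z0|r0 s x0 y0|f r1 s p q w dp dq dw
    |f r1 s p q w dp dq dw].
  - by solve_linear.
  - by solve_linear.
  - by solve_linear.
  - rewrite mulrA (mulr_shift_r _ dx) -[mu_r A _ * x * p]mulrA antipode_mu_r //.
    by rewrite -[_ * mu_l A _ * y]mulrA -(mulr_shift_l _ dy) !mulrA.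
  - by rewrite (antipode_mu_lM _ dw) (mu_r_shift _ dq) !mulrA.
(* Here the factor b_2 S(b_3) is already contracted to mu_l of a counit. *)
transitivity (\sum_(k < sw_size b) \sum_(i < sw_size a) \sum_(j < sw_size (rgt a i))
    S (lft a i * lft b k) * lft (rgt a i) j * mu_l A (eps (rgt b k) 1) * S (rgt (rgt a i) j)).
  rewrite exchange_big /=.
  transitivity (\sum_(i < sw_size a) \sum_(k < sw_size b)
     S (mu_r A (eps (rgt a i) 1) * lft a i * (mu_r A (eps (rgt b k) 1) * lft b k))).
    rewrite -{1}[a]counit_r -{1}[b]counit_r mulr_suml linear_sum; apply: eq_bigr => i _.
    by rewrite mulr_sumr linear_sum.
  apply: eq_bigr => i _; apply: eq_bigr => k _; have [dl dr] := sw_deg da i.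
  rewrite mulrA -[_ * lft a i * mu_r A _]mulrA (mulr_shift_r _ dl) !mulrA -rmorphM.
  rewrite -mulrA antipode_mu_r // mulrC rmorphM /= -(antipode_r (rgt a i)) mulr_sumr mulr_sumr.
  apply: eq_bigr => j _; have [drl drr] := sw_deg dr j.
  by rewrite !mulrA -[_ * mu_l A _ * lft _ _]mulrA -(mulr_shift_l _ drl) !mulrA.
under eq_bigr => k _ do rewrite -(coassoc (balA (lft b k) (eps (rgt b k) 1)) da).
rewrite exchange_big /=.
transitivity (\sum_(i < sw_size a) \sum_(j < sw_size (lft a i))
    \sum_(k < sw_size b) \sum_(l < sw_size (lft b k))
    S (lft (lft a i) j * lft (lft b k) l) * rgt (lft a i) j * rgt (lft b k) l *
    S (rgt b k) * S (rgt a i)).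
  apply: eq_bigr => i _; rewrite exchange_big /=; apply: eq_bigr => j _.
  have [dl dr] := sw_deg da i; have [dll dlr] := sw_deg dl j.
  rewrite (coassoc (balB _ _ _ _ _ (rgt a i) dll dlr) db).
  apply: eq_bigr => k _; rewrite -(antipode_r (rgt b k)) mulr_sumr mulr_suml.
  by apply: eq_bigr => l _; rewrite !mulrA.
transitivity (\sum_(i < sw_size a) S b * S (mu_l A (eps (lft a i) 1) * rgt a i)); last first.
  by rewrite -mulr_sumr -linear_sum counit_l.
apply: eq_bigr => i _; rewrite exchange_big /=; have [dl dr] := sw_deg da i.
transitivity (\sum_(k < sw_size b) mu_r A (shiftM al' (shiftM al (eps (lft a i) 1))) *
   S (mu_l A (eps (lft b k) 1) * rgt b k) * S (rgt a i)); last first.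
  rewrite -mulr_suml -mulr_sumr -linear_sum counit_l.
  rewrite (mu_r_shift _ (antipode_deg db)) shiftMD addNr shiftM0.
  by rewrite (eps_shift_eq dl) (antipode_mu_lM _ dr) mulrA.
apply: eq_bigr => k _; have [dbl dbr] := sw_deg db k.
rewrite (antipode_mu_lM _ dbr) -(eps_shift_eq dbl) mulrA -rmorphM.
have -> : shiftM al' (shiftM al (eps (lft a i) 1)) * shiftM al' (eps (lft b k) 1) =
    shiftM (al + al') (eps (lft a i * lft b k) 1).
  rewrite epsM /= (eps_shiftE (eps (lft b k) 1) dl) rmorphM !shiftMD; congr (_ * _).
    by rewrite addrC.
  by rewrite /= shiftMD addrAC subrr add0r.
have dlb := hdegM dl dbl.
rewrite /= -(antipode_left SA dlb (sweedler_mul (sw_seqP _) (sw_seqP _))).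
rewrite big_allpairs_dep sum_sw /= !mulr_suml; apply: eq_bigr => j _.
rewrite sum_sw !mulr_suml; apply: eq_bigr => l _ /=; by rewrite !mulrA.
Qed.
End Antipode.

(** * The antipode reverses the coproduct *)

Section TensorProduct.
Variables (C : numClosedFieldType) (h : vectType C).
Local Notation hs := 'Hom(h, C^o).
Variable A : hBialgebroid h.
Implicit Types (a b : A).

(** The componentwise product, well defined on matching components only. *)
Definition tmul (x y : tensor A A) : tensor A A :=
  tensor_lift (fun _ a b => tensor_lift (fun _ c d => tens (a * c) (b * d)) y) x.

Lemma tmul_balr al ga be a b : hdeg al ga a -> hdeg ga be b ->
  balanced (fun _ c d => tens (a * c : A) (b * d : A)).
Proof.
move=> da db; split=> [_ d c u v|_ d c u v|f r s t c d dc dd].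
- by rewrite mulrDr -scalerAr tens_linl.
- by rewrite mulrDr -scalerAr tens_linr.
- rewrite mulrA (mulr_shift_r _ da) -mulrA tens_bal !mulrA.
  by rewrite (mulr_shift_l _ db).
Qed.

Lemma tmul_ball y : balanced (fun _ a b => tensor_lift (fun _ c d => tens (a * c) (b * d)) y).
Proof.
split=> [_ b c u v|_ a c u v|f al ga be a b da db].
- by apply: tensor_lift_combo => _ c0 d; rewrite mulrDl -scalerAl tens_linl.
- by apply: tensor_lift_combo => _ c0 d; rewrite mulrDl -scalerAl tens_linr.
- by apply: eq_tensor_lift => ? ? ? c d _ _; rewrite -!mulrA tens_bal.
Qed.

Lemma tmul_linl y : linear (tmul^~ y).
Proof. exact: tensor_lift_linear (tmul_ball y). Qed.

Lemma tmul_tensl al ga be a b y : hdeg al ga a -> hdeg ga be b ->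
  tmul (tens a b) y = tensor_lift (fun _ c d => tens (a * c) (b * d)) y.
Proof. by move=> da db; rewrite /tmul (tensor_lift_tens (tmul_ball y) da db). Qed.

Lemma tmul_sweedlerl x s y : sweedler x s ->
  tmul x y = \sum_(t <- s) tensor_lift (fun _ c d => tens (hleft t * c) (hright t * d)) y.
Proof. by move=> sx; exact: (tensor_lift_sweedler (tmul_ball y) sx). Qed.

Lemma tmul_linr x : linear (tmul x).
Proof.
have [s sx] := sweedler_of x; move=> c y z; rewrite !(tmul_sweedlerl _ sx).
rewrite scaler_sumr -big_split; apply: eq_bigr => t _ /=.
have [al dl] := hleft_deg t; have [be dr] := hright_deg t.
exact: (tensor_lift_linear (tmul_balr dl dr)).
Qed.

Lemma tmul_tens al ga be a b al' ga' be' c d : hdeg al ga a -> hdeg ga be b ->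
  hdeg al' ga' c -> hdeg ga' be' d -> tmul (tens a b) (tens c d) = tens (a * c) (b * d).
Proof.
move=> da db dc dd; rewrite (tmul_tensl _ da db).
by rewrite (tensor_lift_tens (tmul_balr da db) dc dd).
Qed.

Lemma tmul_sweedler x y s t : sweedler x s -> sweedler y t ->
  sweedler (tmul x y) [seq hterm_mul u v | u <- s, v <- t].
Proof.
move=> sx ty; rewrite /sweedler (tmul_sweedlerl _ sx) big_allpairs_dep.
apply: eq_bigr => u _.
have [al dl] := hleft_deg u; have [be dr] := hright_deg u.
by rewrite (tensor_lift_sweedler (tmul_balr dl dr) ty).
Qed.

Lemma tmulA x y z : tmul x (tmul y z) = tmul (tmul x y) z.
Proof.
have [s sx] := sweedler_of x; have [t sy] := sweedler_of y; have [u sz] := sweedler_of z.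
rewrite (tmul_sweedler sx (tmul_sweedler sy sz)) (tmul_sweedler (tmul_sweedler sx sy) sz).
rewrite !big_allpairs_dep; apply: eq_bigr => p _; rewrite !big_allpairs_dep.
by apply: eq_bigr => q _; apply: eq_bigr => r _ /=; rewrite !mulrA.
Qed.

Lemma DeltaM_tmul a b : Delta (a * b) = tmul (Delta a) (Delta b).
Proof.
rewrite (tmul_sweedler (sw_seqP a) (sw_seqP b)).
by rewrite -(sweedler_mul (sw_seqP a) (sw_seqP b)).
Qed.

(** Since mu_l f has coproduct mu_l f (x) 1, it multiplies the first factor of an
    expansion; likewise mu_r f multiplies the last one. *)
Lemma sw_mu_l (N : lmodType C) (phi : hs -> A -> A -> N) f a : balanced phi ->
  \sum_(i < sw_size (mu_l A f * a))
    phi (mid (mu_l A f * a) i) (lft (mu_l A f * a) i) (rgt (mu_l A f * a) i) =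
  \sum_(i < sw_size a) phi (mid a i) (mu_l A f * lft a i) (rgt a i).
Proof.
move=> bphi.
have sf : sweedler (Delta (mu_l A f)) [:: HTerm (ex_intro _ 0 (mu_l_deg A f)) (ex_intro _ 0 (@hdeg1 _ _ A))].
  by rewrite /sweedler big_seq1 Delta_mu_l.
rewrite (sw_indep bphi (sweedler_mul sf (sw_seqP a))) big_allpairs_dep big_seq1 sum_sw.
by apply: eq_bigr => i _ /=; rewrite add0r mul1r.
Qed.

Lemma sw_mu_r (N : lmodType C) (phi : hs -> A -> A -> N) f a : balanced phi ->
  \sum_(i < sw_size (mu_r A f * a))
    phi (mid (mu_r A f * a) i) (lft (mu_r A f * a) i) (rgt (mu_r A f * a) i) =
  \sum_(i < sw_size a) phi (mid a i) (lft a i) (mu_r A f * rgt a i).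
Proof.
move=> bphi.
have sf : sweedler (Delta (mu_r A f)) [:: HTerm (ex_intro _ 0 (@hdeg1 _ _ A)) (ex_intro _ 0 (mu_r_deg A f))].
  by rewrite /sweedler big_seq1 Delta_mu_r.
rewrite (sw_indep bphi (sweedler_mul sf (sw_seqP a))) big_allpairs_dep big_seq1 sum_sw.
by apply: eq_bigr => i _ /=; rewrite add0r mul1r.
Qed.

Variable S : {linear A -> A}.
Hypothesis SA : is_antipode S.

Lemma flipS_bal : balanced (fun _ : hs => fun a b : A => tens (S b) (S a)).
Proof.
split=> [_ b c u v|_ a c u v|f al ga be a b da db].
- by rewrite linearP tens_linr.
- by rewrite linearP tens_linl.
rewrite (antipode_mu_lM SA _ db) antipode_mu_r // tens_bal.
by rewrite (mulr_shift_l _ (antipode_deg SA da)) opprK.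
Qed.

Definition flipS a : tensor A A := tensor_lift (fun _ a b => tens (S b) (S a)) (Delta a).

Lemma flipSE a : flipS a = \sum_(i < sw_size a) tens (S (rgt a i)) (S (lft a i)).
Proof. by rewrite /flipS (tensor_lift_sweedler flipS_bal (sw_seqP a)) sum_sw. Qed.

Lemma flipS_linear : linear flipS.
Proof. by move=> c a b; rewrite /flipS linearP (tensor_lift_linear flipS_bal). Qed.

Lemma flipS_mu_l r s a f : hdeg r s a ->
  flipS (mu_l A f * a) = tmul (tens 1 (mu_r A (shiftM r f))) (flipS a).
Proof.
move=> da; rewrite !flipSE (sw_mu_l f a flipS_bal) (linear_sums (tmul_linr _)).
apply: eq_bigr => i _; have [dl dr] := sw_deg da i.
rewrite (tmul_tens (@hdeg1 _ _ A) (mu_r_deg A _) (antipode_deg SA dr) (antipode_deg SA dl)).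
by rewrite mul1r (antipode_mu_lM SA _ dl).
Qed.

(** With (x) the tensor sign, the left side is \sum a_1 S(a_4) (x) a_2 S(a_3). Coassociativity
    is used twice to group a_2 with a_3; then a_2 S(a_3) is contracted, the resulting
    mu_l of a counit moves through (x) and is absorbed in a_4, and a_1 S(a_2) remains. *)
Lemma flipS_inv al be a : hdeg al be a ->
  \sum_(i < sw_size a) tmul (Delta (lft a i)) (flipS (rgt a i)) = Delta (mu_l A (eps a 1)).
Proof.
move=> da.
have bal1 : balanced3 al be (fun _ _ x y z => tmul (tens x y) (flipS z)).
  split=> [r s y z c u v|r s x z c u v|r s x y c u v|f r s x y z dx dy dz|f r s x y z dx dy dz].
  - by rewrite tens_linl tmul_linl.
  - by rewrite tens_linr tmul_linl.
  - by rewrite flipS_linear tmul_linr.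
  - by rewrite tens_bal.
  - rewrite (flipS_mu_l _ dz) tmulA (tmul_tens dx dy (@hdeg1 _ _ A) (mu_r_deg A _)).
    by rewrite mulr1 -(mu_r_shift _ dy).
transitivity (\sum_(i < sw_size a) \sum_(j < sw_size (lft a i))
   tmul (tens (lft (lft a i) j) (rgt (lft a i) j)) (flipS (rgt a i))).
  by apply: eq_bigr => i _; rewrite {1}DeltaE (linear_sums (tmul_linl _)).
rewrite (coassoc bal1 da) Delta_mu_l -(antipode_r SA) (linear_sums (tens_linl _)).
apply: eq_bigr => i _; have [dl dr] := sw_deg da i.
have bal2 : balanced3 (mid a i) be (fun _ _ p q w => tens (lft a i * S w) (p * S q)).
  split=> [r s y z c u v|r s x z c u v|r s x y c u v|f r s x y z dx dy dz|f r s x y z dx dy dz].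
  - by rewrite mulrDl -scalerAl tens_linr.
  - by rewrite linearP mulrDr -scalerAr tens_linr.
  - by rewrite linearP mulrDr -scalerAr tens_linl.
  - by rewrite (antipode_mu_lM SA _ dy) mulrA -(mu_r_shift _ dx).
  - rewrite antipode_mu_r // (antipode_mu_lM SA _ dz) [in RHS]mulrA.
    rewrite (mulr_shift_r _ dl) -[in RHS]mulrA tens_bal mulrA.
    rewrite (mulr_shift_l _ (hdegM dx (antipode_deg SA dy))) shiftMD.
    by rewrite opprD opprK addrC.
transitivity (\sum_(j < sw_size (rgt a i)) \sum_(k < sw_size (rgt (rgt a i) j))
   tens (lft a i * S (rgt (rgt (rgt a i) j) k))
     (lft (rgt a i) j * S (lft (rgt (rgt a i) j) k))).
  apply: eq_bigr => j _; rewrite flipSE (linear_sums (tmul_linr _)); apply: eq_bigr => k _.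
  have [drl drr] := sw_deg dr j; have [drrl drrr] := sw_deg drr k.
  by rewrite (tmul_tens dl drl (antipode_deg SA drrr) (antipode_deg SA drrl)).
rewrite -(coassoc bal2 dr).
transitivity (\sum_(j < sw_size (rgt a i))
  tens (lft a i * S (mu_l A (eps (lft (rgt a i) j) 1) * rgt (rgt a i) j)) (1 : A)).
  apply: eq_bigr => j _; have [drl drr] := sw_deg dr j.
  rewrite -(linear_sums (tens_linr _)) (antipode_r SA) -[X in tens _ X = _]mulr1 -tens_bal.
  by rewrite (antipode_mu_lM SA _ drr) -(eps_shift_eq drl) mulrA (mu_r_shift _ dl) mulrA.
by rewrite -(linear_sums (tens_linl _)) -mulr_sumr -linear_sum counit_l.
Qed.

(** In the algebra of tensors, Delta o S is a left convolution inverse of Delta because Delta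
    is multiplicative, and flipS is a right one by flipS_inv. As for the uniqueness of the
    antipode, the two agree. *)
Lemma Delta_antipode a :
  Delta (S a) = \sum_(i < sw_size a) tens (S (rgt a i)) (S (lft a i)).
Proof.
rewrite -flipSE; move: a; apply: homog_ext => [a b|a b|al be a da].
- by rewrite !linearD.
- exact: (linear_add flipS_linear).
have bal : balanced3 al be (fun _ _ x y z => tmul (Delta (S x * y)) (flipS z)).
  split=> [r s y z c u v|r s x z c u v|r s x y c u v|f r s x y z dx dy dz|f r s x y z dx dy dz].
  - by rewrite linearP mulrDl -scalerAl linearP tmul_linl.
  - by rewrite mulrDr -scalerAr linearP tmul_linl.
  - by rewrite flipS_linear tmul_linr.
  - by rewrite antipode_mu_r // mulrA.
  - rewrite (flipS_mu_l _ dz) tmulA -Delta_mu_r -DeltaM_tmul.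
    by rewrite -mulrA -(mu_r_shift _ dy).
have := coassoc bal da.
under eq_bigr => i _ do [have [dl dr] := sw_deg da i;
  rewrite -(linear_sums (tmul_linl _)) -linear_sum (antipode_l SA dl) Delta_mu_r
    (eps_shift_eq dl) -(flipS_mu_l _ dr)].
rewrite -(linear_sums flipS_linear) counit_l => ->.
rewrite -{1}(counit_r a) !linear_sum; apply: eq_bigr => i _; have [dl dr] := sw_deg da i.
under eq_bigr do rewrite DeltaM_tmul -tmulA.
by rewrite -(linear_sums (tmul_linr _)) (flipS_inv dr) -DeltaM_tmul antipode_mu_r.
Qed.
End TensorProduct.

(** * Star operations *)

Section Star.
Variables (C : numClosedFieldType) (h : vectType C).
Local Notation hs := 'Hom(h, C^o).
Variable cj : conjugation hs.

Section StarAlgebra.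
Variables (A : hAlgebra h) (st : A -> A).
Hypothesis stP : is_star cj st.

Lemma starD : {morph st : a b / a + b}.
Proof. by move=> a b; have := star_antilinear stP 1 a b; rewrite rmorph1 !scale1r. Qed.

Lemma star0 : st 0 = 0.
Proof. by have := starD 0 0; rewrite addr0 -{1}[st 0]addr0 => /addrI <-. Qed.

Lemma star_sum (I : Type) (r : seq I) (P : pred I) (G : I -> A) :
  st (\sum_(i <- r | P i) G i) = \sum_(i <- r | P i) st (G i).
Proof. exact: (big_morph st starD star0). Qed.

(** A star operation is not assumed to respect the grading, but it respects the moment maps,
    and these determine the grading. *)
Lemma star_deg al be a : hdeg al be a -> hdeg (- cj al) (- cj be) (st a).
Proof.
move=> da; apply: hdeg_moment => f.
  rewrite -{1}[f](barMK cj) -(star_mu_l stP) -(starM stP) (mulr_shift_l _ da).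
  by rewrite (starM stP) (star_mu_l stP) barM_shift barMK conj_funN.
rewrite -{1}[f](barMK cj) -(star_mu_r stP) -(starM stP) (mulr_shift_r _ da).
by rewrite (starM stP) (star_mu_r stP) barM_shift barMK conj_funN.
Qed.

Section HtermStar.
Variable t : hterm A A.
Fact hterm_star_l : exists al, hdeg al (- cj (hmid t)) (st (hleft t)).
Proof. by have [al dl] := hleft_deg t; exists (- cj al); exact: star_deg. Qed.
Fact hterm_star_r : exists be, hdeg (- cj (hmid t)) be (st (hright t)).
Proof. by have [be dr] := hright_deg t; exists (- cj be); exact: star_deg. Qed.
Definition hterm_star := HTerm hterm_star_l hterm_star_r.
End HtermStar.
End StarAlgebra.

Section HopfStar.
Variables (A : hBialgebroid h) (st : A -> A).
Hypothesis stP : is_hopf_star cj st.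
Let sP := hopf_star_star stP.

Lemma sweedler_star a s : sweedler (Delta a) s ->
  sweedler (Delta (st a)) [seq hterm_star sP t | t <- s].
Proof. by move=> sa; rewrite /sweedler big_map (hopf_star_Delta stP sa). Qed.

Lemma eps_star al be a : hdeg al be a -> eps (st a) 1 = shiftM (cj al) (barM cj (eps a 1)).
Proof.
move=> da; rewrite (@hopf_star_eps _ _ _ _ _ stP a
  (fun g => \sum_(p <- [:: (eps a 1, - al)]) shiftM (- cj p.2) (barM cj p.1 * g))).
  by rewrite big_seq1 /= mulr1 conj_funN opprK.
exists [:: (eps a 1, - al)]; split=> //; apply/funext => g.
by rewrite /fdo big_seq1 (eps_shiftE g da).
Qed.

Variable S : {linear A -> A}.
Hypothesis SA : is_antipode S.

(** Conjugating S by the star gives a map S' with \sum S'(a_2) a_1 = mu_l of a function. Applying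
    the antimultiplicative S shows that S o S' is a right convolution inverse of S, while the
    identity is a left one. *)
Lemma antipode_starK a : S (st (S (st a))) = a.
Proof.
have lS : linear (fun z => S (st (S (st z)))).
  by move=> c u v; rewrite !(star_antilinear sP, linearP) /= conjCK.
move: a; apply: homog_ext => [a b|//|al be a da]; first exact: (linear_add lS).
have mulS z f : S (st (S (st (mu_l A f * z)))) = mu_l A f * S (st (S (st z))).
  rewrite (starM sP) (star_mu_l sP) antipode_mu_l // (starM sP) (star_mu_r sP) barMK.
  by rewrite (antipodeM SA) (antipode_mu_rE SA).
have bal : balanced3 al be (fun _ _ x y z => x * S y * S (st (S (st z)))).
  split=> [r s y z c u v|r s x z c u v|r s x y c u v|f r s x y z dx dy dz|f r s x y z dx dy dz].
  - by rewrite !mulrDl -!scalerAl.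
  - by rewrite linearP mulrDr mulrDl -scalerAr -scalerAl.
  - by rewrite lS mulrDr -scalerAr.
  - by rewrite (antipode_mu_lM SA _ dy) mulrA -(mu_r_shift _ dx).
  - by rewrite antipode_mu_r // mulS !mulrA.
have SLinv r s z : hdeg r s z ->
    \sum_(i < sw_size z) S (lft z i) * S (st (S (st (rgt z i)))) =
    mu_r A (shiftM r (eps z 1)).
  move=> dz; under eq_bigr do rewrite -(antipodeM SA).
  rewrite -linear_sum -(antipode_mu_lE SA); congr (S _).
  transitivity (st (\sum_(i < sw_size z) st (lft z i) * S (st (rgt z i)))).
    by rewrite (star_sum sP); apply: eq_bigr => i _; rewrite (starM sP) (starK sP).
  have := antipode_right SA (sweedler_star (sw_seqP z)).
  rewrite big_map sum_sw /= => ->.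
  by rewrite (star_mu_l sP) (eps_star dz) barM_shift barMK conj_involutive.
have := coassoc bal da.
under eq_bigr => i _ do rewrite -mulr_suml (antipode_r SA) -mulS.
rewrite -(linear_sums lS) counit_l => ->.
rewrite -[RHS]counit_r; apply: eq_bigr => i _; have [dl dr] := sw_deg da i.
under eq_bigr do rewrite -mulrA.
by rewrite -mulr_sumr (SLinv _ _ _ dr) -(mu_r_shift _ dl).
Qed.
End HopfStar.
End Star.

Lemma subDK (V : zmodType) (x y : V) : x - (x + y) + y = 0.
Proof. by rewrite opprD addrA subrr add0r addNr. Qed.

Lemma addDK (V : zmodType) (x y z : V) : z + x - (x + y) + y = z.
Proof. by rewrite -2!(addrA z) subDK addr0. Qed.

(** * The two actions *)

Section Actions.
Variables (C : numClosedFieldType) (h : vectType C).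
Local Notation hs := 'Hom(h, C^o).
Local Notation M := (mero hs).
Variables (U A : hBialgebroid h) (pr : U -> A -> M -> M).
Hypothesis prP : is_pairing pr.
Implicit Types (X Y : U) (a b : A).

Lemma pr_linX a g : linear (fun X => pr X a g).
Proof. by move=> c X Y; exact: pairing_linl. Qed.

Lemma pr_lina X g : linear (fun a => pr X a g).
Proof. by move=> c a b; exact: pairing_linr. Qed.

Lemma pr_ling X a : linear (pr X a).
Proof.
have [s ->] := pairing_fdo prP X a; move=> c f g.
rewrite /fdo scaler_sumr -big_split; apply: eq_bigr => p _ /=.
by rewrite linearP mulrDr scalerAr.
Qed.

Lemma pr_mu_lA f X a g : pr X (mu_l A f * a) g = f * pr X a g.
Proof. by rewrite pairing_mu_lA. Qed.
Lemma pr_mu_lU f X a g : pr (mu_l U f * X) a g = f * pr X a g.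
Proof. by rewrite pairing_mu_lU. Qed.
Lemma pr_mu_rA f X ga de a g : hdeg ga de a ->
  pr X (mu_r A f * a) g = pr X a (shiftM de f * g).
Proof. by move=> da; rewrite (mu_r_shift _ da) pairing_mu_rA. Qed.
Lemma pr_mu_rU f al be X a g : hdeg al be X ->
  pr (mu_r U f * X) a g = pr X a (shiftM be f * g).
Proof. by move=> dX; rewrite (mu_r_shift _ dX) pairing_mu_rU. Qed.

Lemma pr_off al be ga de X a : hdeg al be X -> hdeg ga de a ->
  al + de != be + ga -> pr X a = fun=> 0.
Proof. by move=> dX da /negbTE n; have := pairing_deg prP dX da; rewrite /fdo_deg n. Qed.

(** <X, a> is a single term f T_{-w}; f is its value at 1, and w may be read as the left or
    as the right weight. When these differ the pairing is zero, so both readings hold. *)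
Lemma pr_shift_left al be ga de X a g : hdeg al be X -> hdeg ga de a ->
  pr X a g = pr X a 1 * shiftM (- (al + de)) g.
Proof.
move=> dX da; have := pairing_deg prP dX da; rewrite /fdo_deg.
by case: eqP => [_ [f ->]|_ ->]; rewrite ?mul0r // rmorph1 mulr1.
Qed.

Lemma pr_shift_right al be ga de X a g : hdeg al be X -> hdeg ga de a ->
  pr X a g = pr X a 1 * shiftM (- (be + ga)) g.
Proof.
move=> dX da; have [<-|n] := eqVneq (al + de) (be + ga); first exact: pr_shift_left dX da.
by rewrite (pr_off dX da n) mul0r.
Qed.

Definition left_form X (_ : hs) (x y : A) : A := mu_r A (pr X y 1) * x.

(** Applying <X, y> to 1 turns mu_l f y into a factor f, which mu_r takes back to x. *)
Lemma left_form_bal X : balanced (left_form X).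
Proof.
split=> [w y c u v|w x c u v|f al ga be x y dx dy]; rewrite /left_form.
- by rewrite mulrDr -scalerAr.
- by rewrite (pr_lina X 1) linearP mulrDl -scalerAl.
- by rewrite pr_mu_lA mulrA -rmorphM mulrC.
Qed.

Definition left_action X a : A := tensor_lift (left_form X) (Delta a).

Lemma lact_sw X a s : sweedler (Delta a) s ->
  left_action X a = \sum_(t <- s) mu_r A (pr X (hright t) 1) * hleft t.
Proof. by move=> sa; exact: (tensor_lift_sweedler (left_form_bal X) sa). Qed.

Lemma lactE X a : left_action X a = \sum_(i < sw_size a) mu_r A (pr X (rgt a i) 1) * lft a i.
Proof. by rewrite (lact_sw _ (sw_seqP a)) sum_sw. Qed.

Lemma lact_linX a : linear (left_action^~ a).
Proof.
move=> c X Y; apply: tensor_lift_combo => w x y.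
by rewrite /left_form (pr_linX y 1) linearP mulrDl -scalerAl.
Qed.

Lemma lact_lina X : linear (left_action X).
Proof. by move=> c a b; rewrite /left_action linearP (tensor_lift_linear (left_form_bal X)). Qed.

Definition right_form (al : hs) X (_ : hs) (x y : A) : A := mu_l A (shiftM al (pr X x 1)) * y.

(** For x of right weight r, mu_r f x = x mu_r (T_r f) contributes the factor
    T_{-(al + r)} T_r f = T_{-al} f to <X, x> 1; the shift by al undoes it. *)
Lemma right_form_bal al be X : hdeg al be X -> balanced (right_form al X).
Proof.
move=> dX; split=> [w y c u v|w x c u v|f ga r de x y dx dy]; rewrite /right_form.
- by rewrite (pr_lina X 1) linearP linearP mulrDl -scalerAl.
- by rewrite mulrDr -scalerAr.
- rewrite (pr_mu_rA _ _ _ dx) mulr1 (pr_shift_left _ dX dx) !rmorphM /= !shiftMD.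
  by rewrite subDK shiftM0 mulrA.
Qed.

Let rlin a : forall al be : hs, linear (fun X => tensor_lift (right_form al X) (Delta a)).
Proof.
move=> al be c X Y; apply: tensor_lift_combo => w x y.
by rewrite /right_form (pr_linX x 1) linearP linearP mulrDl -scalerAl.
Qed.

(** The formula involves the left weight of X, so it is glued from the components of X. *)
Definition right_action a X : A := hsum (fun al _ X => tensor_lift (right_form al X) (Delta a)) X.

Lemma ract_sw al be X a s : hdeg al be X -> sweedler (Delta a) s ->
  right_action a X = \sum_(t <- s) mu_l A (shiftM al (pr X (hleft t) 1)) * hright t.
Proof.
move=> dX sa; rewrite /right_action (hsum_homog (rlin a) dX).
exact: (tensor_lift_sweedler (right_form_bal dX) sa).
Qed.

Lemma ractE al be X a : hdeg al be X ->
  right_action a X = \sum_(i < sw_size a) mu_l A (shiftM al (pr X (lft a i) 1)) * rgt a i.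
Proof. by move=> dX; rewrite (ract_sw dX (sw_seqP a)) sum_sw. Qed.

Lemma ract_linX a : linear (right_action a).
Proof. exact: (hsum_linear (rlin a)). Qed.

Lemma ract_lina X : linear (right_action^~ X).
Proof.
move=> c a b; have [_ dX _ ->] := hcompP X.
rewrite !(linear_sums (ract_linX _)) scaler_sumr -big_split; apply: eq_bigr => d _ /=.
rewrite /right_action !(hsum_homog (rlin _) (dX d)) linearP.
exact: (tensor_lift_linear (right_form_bal (dX d))).
Qed.

Lemma left_action_act : is_left_act pr left_action.
Proof.
split=> [a|al be X a s dX sa]; first exact: lact_linX.
rewrite (lact_sw _ sa); apply: eq_bigr => t _.
by rewrite /opr /= rmorph1.
Qed.

Lemma right_action_act : is_right_act pr right_action.
Proof. by split=> [a|al be X a s dX sa]; [exact: ract_linX|exact: ract_sw dX sa]. Qed.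

Lemma left_act_uniq lact : is_left_act pr lact -> lact = left_action.
Proof.
move=> [linE E]; apply/funext => X; apply/funext => a; move: X.
apply: homog_ext; [exact: (linear_add (linE a))|exact: (linear_add (lact_linX a))|].
move=> al be X dX; rewrite (E _ _ _ _ _ dX (sw_seqP a)).
by have [_ E'] := left_action_act; rewrite (E' _ _ _ _ _ dX (sw_seqP a)).
Qed.

Lemma right_act_uniq ract : is_right_act pr ract -> ract = right_action.
Proof.
move=> [linE E]; apply/funext => a; apply/funext.
apply: homog_ext; [exact: (linear_add (linE a))|exact: (linear_add (ract_linX a))|].
by move=> al be X dX; rewrite (E _ _ _ _ _ dX (sw_seqP a)) (ract_sw dX (sw_seqP a)).
Qed.

Lemma lact_deg al be ga de X a : hdeg al be X -> hdeg ga de a ->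
  hdeg ga (de + al - be) (left_action X a).
Proof.
move=> dX da; rewrite lactE; apply: hdeg_sum => i; have [dl dr] := sw_deg da i.
have [E|n] := eqVneq (al + de) (be + mid a i).
  by apply: hdeg_mu_rM; rewrite [de + al]addrC E addrAC subrr add0r.
by rewrite (pr_off dX dr n) rmorph0 mul0r; exact: hdeg0.
Qed.

Lemma ract_deg al be ga de X a : hdeg al be X -> hdeg ga de a ->
  hdeg (ga + be - al) de (right_action a X).
Proof.
move=> dX da; rewrite (ractE _ dX); apply: hdeg_sum => i; have [dl dr] := sw_deg da i.
have [E|n] := eqVneq (al + mid a i) (be + ga).
  by apply: hdeg_mu_lM; rewrite [ga + be]addrC -E addrAC subrr add0r.
by rewrite (pr_off dX dl n) !rmorph0 mul0r; exact: hdeg0.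
Qed.

Lemma lact_unit a : left_action 1 a = a.
Proof. by rewrite lactE -[RHS]counit_r; apply: eq_bigr => i _; rewrite (pairing1l prP). Qed.

Lemma ract_unit a : right_action a 1 = a.
Proof.
rewrite (ractE _ (@hdeg1 _ _ U)) -[RHS]counit_l; apply: eq_bigr => i _.
by rewrite (pairing1l prP) shiftM0.
Qed.

Lemma lact_mu_l X f a : left_action X (mu_l A f * a) = mu_l A f * left_action X a.
Proof.
rewrite !lactE (sw_mu_l f a (left_form_bal X)) mulr_sumr; apply: eq_bigr => i _.
by rewrite /left_form !mulrA mu_lrC.
Qed.

(** Both sides are \sum mu_r (<X, a_2> T_rho <Y, a_3> 1) a_1, where rho is the weight between
    a_2 and a_3: on the left by the pairing rule for XY, on the right because the factor
    mu_r (<Y, a_3> 1) is absorbed into the second argument of <X, _>. *)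
Lemma lactM a X Y : left_action (X * Y) a = left_action X (left_action Y a).
Proof.
move: a; apply: homog_ext => [a b|a b|ga de a da].
- exact: (linear_add (lact_lina _)).
- by rewrite (linear_add (lact_lina Y)) (linear_add (lact_lina X)).
have bal : balanced3 ga de
    (fun _ s x y z => mu_r A (pr X y (shiftM s (pr Y z 1))) * x).
  split=> [r s y z c u v|r s x z c u v|r s x y c u v|f r s x y z dx dy dz|f r s x y z dx dy dz].
  - by rewrite mulrDr -scalerAr.
  - by rewrite (pr_lina X) linearP mulrDl -scalerAl.
  - by rewrite (pr_lina Y) linearP (pr_ling X) linearP mulrDl -scalerAl.
  - by rewrite pr_mu_lA mulrA -rmorphM mulrC.
  - by rewrite (pr_mu_rA _ _ _ dy) pr_mu_lA rmorphM.
transitivity (\sum_(i < sw_size a) \sum_(j < sw_size (rgt a i))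
   mu_r A (pr X (lft (rgt a i) j) (shiftM (mid (rgt a i) j) (pr Y (rgt (rgt a i) j) 1))) *
   lft a i).
  rewrite lactE; apply: eq_bigr => i _.
  by rewrite (pairing_mull prP _ _ (sw_seqP (rgt a i))) sum_sw rmorph_sum mulr_suml.
rewrite -(coassoc bal da) (lactE Y a) (linear_sums (lact_lina X)).
apply: eq_bigr => i _; rewrite lactE (sw_mu_r _ _ (left_form_bal X)).
apply: eq_bigr => j _; have [dl dr] := sw_deg da i; have [dll dlr] := sw_deg dl j.
by rewrite /left_form (pr_mu_rA _ _ _ dlr) mulr1.
Qed.

(** Both sides are the sum over a_1, a_2, a_3 of
    mu_l (T_al' (T_al (<X, a_1> 1) . <Y, a_2> 1)) a_3. *)
Lemma ractM a X Y : right_action a (X * Y) = right_action (right_action a X) Y.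
Proof.
move: X; apply: homog_ext => [X X'|X X'|al be X dX].
- by rewrite mulrDl (linear_add (ract_linX a)).
- by rewrite (linear_add (ract_linX a)) (linear_add (ract_lina Y)).
move: Y; apply: homog_ext => [Y Y'|Y Y'|al' be' Y dY].
- by rewrite mulrDr (linear_add (ract_linX a)).
- by rewrite (linear_add (ract_linX _)).
move: a; apply: homog_ext => [a b|a b|ga de a da].
- by rewrite (linear_add (ract_lina _)).
- by rewrite (linear_add (ract_lina X)) (linear_add (ract_lina Y)).
have bal : balanced3 ga de
    (fun _ _ x y z => mu_l A (shiftM al' (shiftM al (pr X x 1) * pr Y y 1)) * z).
  split=> [r s y z c u v|r s x z c u v|r s x y c u v|f r s x y z dx dy dz|f r s x y z dx dy dz].
  - by rewrite (pr_lina X) linearP mulrDl -scalerAl !linearP mulrDl -scalerAl.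
  - by rewrite (pr_lina Y) mulrDr -scalerAr !linearP mulrDl -scalerAl.
  - by rewrite mulrDr -scalerAr.
  - rewrite (pr_mu_rA _ _ _ dx) mulr1 (pr_shift_left _ dX dx) pr_mu_lA !rmorphM /= !shiftMD.
    by rewrite addDK !mulrA.
  - rewrite (pr_mu_rA _ _ _ dy) mulr1 (pr_shift_left _ dY dy) !rmorphM /= !shiftMD.
    by rewrite subDK shiftM0 !mulrA.
transitivity (\sum_(i < sw_size a) \sum_(j < sw_size (lft a i))
   mu_l A (shiftM al' (shiftM al (pr X (lft (lft a i) j) 1) * pr Y (rgt (lft a i) j) 1)) *
   rgt a i).
  rewrite (ractE _ (hdegM dX dY)); apply: eq_bigr => i _.
  rewrite (pairing_mull prP _ _ (sw_seqP (lft a i))) sum_sw !rmorph_sum mulr_suml.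
  apply: eq_bigr => j _; congr (mu_l A _ * _).
  have [dl dr] := sw_deg da i; have [dll dlr] := sw_deg dl j.
  rewrite (pr_shift_left _ dX dll) !rmorphM /= !shiftMD [al + al']addrC.
  by rewrite addDK.
rewrite (coassoc bal da) (ractE a dX) (linear_sums (ract_lina Y)).
apply: eq_bigr => i _; rewrite (ractE _ dY) (sw_mu_l _ _ (right_form_bal dY)).
by apply: eq_bigr => j _; rewrite /right_form pr_mu_lA.
Qed.

(** X acts through the last and Y through the first factor of a_1, a_2, a_3. *)
Lemma lract_comm a X Y : right_action (left_action X a) Y = left_action X (right_action a Y).
Proof.
move: Y; apply: homog_ext => [Y Y'|Y Y'|al be Y dY].
- by rewrite (linear_add (ract_linX _)).
- by rewrite (linear_add (ract_linX _)) (linear_add (lact_lina X)).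
move: a; apply: homog_ext => [a b|a b|ga de a da].
- by rewrite (linear_add (lact_lina _)) (linear_add (ract_lina _)).
- by rewrite (linear_add (ract_lina _)) (linear_add (lact_lina _)).
have bal : balanced3 ga de
    (fun _ _ x y z => mu_l A (shiftM al (pr Y x 1)) * (mu_r A (pr X z 1) * y)).
  split=> [r s y z c u v|r s x z c u v|r s x y c u v|f r s x y z dx dy dz|f r s x y z dx dy dz].
  - by rewrite (pr_lina Y) !linearP mulrDl -scalerAl.
  - by rewrite !mulrDr -!scalerAr.
  - by rewrite (pr_lina X) linearP mulrDl -scalerAl mulrDr -scalerAr.
  - rewrite (pr_mu_rA _ _ _ dx) mulr1 (pr_shift_left _ dY dx) !rmorphM /= !shiftMD.
    rewrite subDK shiftM0 !mulrA; congr (_ * _).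
    by rewrite -!mulrA mu_lrC.
  - by rewrite pr_mu_lA [f * _]mulrC rmorphM -!mulrA.
rewrite (lactE X a) (linear_sums (ract_lina Y)) (ractE a dY) (linear_sums (lact_lina X)).
transitivity (\sum_(i < sw_size a) \sum_(j < sw_size (lft a i))
   mu_l A (shiftM al (pr Y (lft (lft a i) j) 1)) *
   (mu_r A (pr X (rgt a i) 1) * rgt (lft a i) j)).
  by apply: eq_bigr => i _; rewrite (ractE _ dY) (sw_mu_r _ _ (right_form_bal dY)).
rewrite (coassoc bal da); apply: eq_bigr => i _.
rewrite lact_mu_l lactE mulr_sumr; by apply: eq_bigr.
Qed.
End Actions.

(** * Products, antipodes and stars *)

Section ModuleAlgebra.
Variables (C : numClosedFieldType) (h : vectType C).
Local Notation hs := 'Hom(h, C^o).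
Local Notation M := (mero hs).
Variables (U A : hBialgebroid h) (pr : U -> A -> M -> M).
Hypothesis prP : is_pairing pr.
Implicit Types (X Y : U) (a b : A).
Local Notation left_action := (left_action pr).
Local Notation right_action := (right_action pr).

(** The moment maps of U act by multiplications in A. This makes the right side of the
    product rules independent of the Sweedler expansion of X. *)
Lemma lact_mu_rU f al be X a : hdeg al be X ->
  left_action (mu_r U f * X) a = left_action X a * mu_r A f.
Proof.
move=> dX; move: a; apply: homog_ext => [a b|a b|ga de a da].
- exact: (linear_add (lact_lina prP _)).
- by rewrite (linear_add (lact_lina prP X)) mulrDl.
rewrite !(lactE prP) mulr_suml; apply: eq_bigr => i _; have [dl dr] := sw_deg da i.
rewrite (pr_mu_rU prP _ _ _ dX) mulr1 (pr_shift_right prP _ dX dr) shiftMD opprD.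
by rewrite addrAC addNr add0r rmorphM -!mulrA -(mulr_shift_r _ dl).
Qed.

Lemma lact_mu_lU f X a : left_action (mu_l U f * X) a = mu_r A f * left_action X a.
Proof.
rewrite !(lactE prP) mulr_sumr; apply: eq_bigr => i _.
by rewrite (pr_mu_lU prP) rmorphM mulrA.
Qed.

Lemma ract_mu_rU f al be X a : hdeg al be X ->
  right_action a (mu_r U f * X) = right_action a X * mu_l A (shiftM be f).
Proof.
move=> dX; move: a; apply: homog_ext => [a b|a b|ga de a da].
- exact: (linear_add (ract_lina prP _)).
- by rewrite (linear_add (ract_lina prP X)) mulrDl.
rewrite (ractE prP _ (hdeg_mu_rM _ dX)) (ractE prP _ dX) mulr_suml; apply: eq_bigr => i _.
have [dl dr] := sw_deg da i.
rewrite (pr_mu_rU prP _ _ _ dX) mulr1 (pr_shift_left prP _ dX dl) rmorphM /= !shiftMD opprD.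
by rewrite addrA subrr add0r rmorphM -!mulrA (mulr_shift_l _ dr) shiftMD.
Qed.

Lemma ract_mu_lU f al be X a : hdeg al be X ->
  right_action a (mu_l U f * X) = mu_l A (shiftM al f) * right_action a X.
Proof.
move=> dX; rewrite (ractE prP _ (hdeg_mu_lM _ dX)) (ractE prP _ dX) mulr_sumr.
by apply: eq_bigr => i _; rewrite (pr_mu_lU prP) !rmorphM mulrA.
Qed.

(** The pairing rule for a product splits <X, a_2 b_2>; the resulting value of <X_2, b_2>,
    shifted by the right weight of a_1, is the factor that commutes past a_1 to b_1. *)
Lemma lact_mul X a b s : sweedler (Delta X) s ->
  left_action X (a * b) = \sum_(t <- s) left_action (hleft t) a * left_action (hright t) b.
Proof.
move=> sX.
have bal : balanced (fun _ x y => left_action x a * left_action y b).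
  split=> [w y c u v|w x c u v|f ga r de x y dx dy].
  - by rewrite (lact_linX prP) mulrDl -scalerAl.
  - by rewrite (lact_linX prP) mulrDr -scalerAr.
  - by rewrite (lact_mu_rU _ _ dx) lact_mu_lU mulrA.
rewrite -(sw_indep bal sX) {bal sX s}.
move: a; apply: homog_ext => [a a'|a a'|ga de a da].
- by rewrite mulrDl (linear_add (lact_lina prP X)).
- by rewrite -big_split; apply: eq_bigr => i _; rewrite (linear_add (lact_lina prP _)) mulrDl.
rewrite (lact_sw prP X (sweedler_mul (sw_seqP a) (sw_seqP b))) big_allpairs_dep sum_sw /=.
under eq_bigr do rewrite sum_sw.
under [RHS]eq_bigr do rewrite !(lactE prP) mulr_suml.
rewrite [RHS]exchange_big /=; apply: eq_bigr => i _.
under [RHS]eq_bigr do rewrite mulr_sumr.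
rewrite [RHS]exchange_big /=; apply: eq_bigr => k _.
rewrite (pairing_mulr prP _ _ (sw_seqP X)) sum_sw rmorph_sum mulr_suml.
apply: eq_bigr => m _; have [al dX1] := hleft_deg (sw X m).
have [dl dr] := sw_deg da i.
rewrite (pr_shift_right prP _ dX1 dr) shiftMD opprD addrAC addNr add0r rmorphM.
by rewrite -!mulrA; congr (_ * _); rewrite !mulrA -(mulr_shift_r _ dl).
Qed.

Lemma ract_mul X a b s : sweedler (Delta X) s ->
  right_action (a * b) X = \sum_(t <- s) right_action a (hleft t) * right_action b (hright t).
Proof.
move=> sX.
have bal : balanced (fun _ x y => right_action a x * right_action b y).
  split=> [w y c u v|w x c u v|f ga r de x y dx dy].
  - by rewrite (ract_linX prP) mulrDl -scalerAl.
  - by rewrite (ract_linX prP) mulrDr -scalerAr.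
  - by rewrite (ract_mu_rU _ _ dx) (ract_mu_lU _ _ dy) mulrA.
rewrite -(tensor_lift_sweedler bal sX) {sX s}.
move: X; apply: homog_ext => [X Y|X Y|al be X dX].
- exact: (linear_add (ract_linX prP _)).
- by rewrite linearD (linear_add (tensor_lift_linear bal)).
rewrite (tensor_lift_sweedler bal (sw_seqP X)) sum_sw {bal}.
move: a; apply: homog_ext => [a a'|a a'|ga de a da].
- by rewrite mulrDl (linear_add (ract_lina prP X)).
- by rewrite -big_split; apply: eq_bigr => i _; rewrite (linear_add (ract_lina prP _)) mulrDl.
rewrite (ract_sw prP dX (sweedler_mul (sw_seqP a) (sw_seqP b))) big_allpairs_dep sum_sw /=.
under eq_bigr do rewrite sum_sw.
under [RHS]eq_bigr => m _ do [have [dX1 dX2] := sw_deg dX m;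
  rewrite (ractE prP _ dX1) (ractE prP _ dX2) mulr_suml].
rewrite [RHS]exchange_big /=; apply: eq_bigr => i _.
under [RHS]eq_bigr do rewrite mulr_sumr.
rewrite [RHS]exchange_big /=; apply: eq_bigr => k _.
rewrite (pairing_mulr prP _ _ (sw_seqP X)) sum_sw !rmorph_sum mulr_suml.
apply: eq_bigr => m _; have [dX1 dX2] := sw_deg dX m.
have [dl dr] := sw_deg da i.
rewrite (pr_shift_left prP _ dX1 dl) rmorphM /= !shiftMD opprD addrA subrr add0r rmorphM.
by rewrite -!mulrA; congr (_ * _); rewrite !mulrA (mulr_shift_l _ dr) shiftMD.
Qed.

Let sw1 : sweedler (Delta (1 : A))
  [:: HTerm (ex_intro _ 0 (@hdeg1 _ _ A)) (ex_intro _ 0 (@hdeg1 _ _ A))].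
Proof. by rewrite /sweedler big_seq1 Delta1. Qed.

Lemma lact_one X : left_action X 1 = mu_r A (eps X 1).
Proof. by rewrite (lact_sw prP X sw1) big_seq1 /= mulr1 (pairing1r prP). Qed.

Lemma ract_one al be X : hdeg al be X -> right_action 1 X = mu_l A (shiftM al (eps X 1)).
Proof. by move=> dX; rewrite (ract_sw prP dX sw1) big_seq1 /= mulr1 (pairing1r prP). Qed.

Section Hopf.
Variables (SU : {linear U -> U}) (SA : {linear A -> A}).
Hypotheses (SUP : is_antipode SU) (SAP : is_antipode SA) (hp : is_hopf_pairing pr SU SA).

Lemma pr_antipode al be ga de X a : hdeg al be X -> hdeg ga de a ->
  pr (SU X) a 1 = shiftM (be - de) (pr X (SA a) 1).
Proof.
move=> dX da; have dS := antipode_deg SAP da.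
rewrite (hp (Q := fun g => \sum_(p <- [:: (pr X (SA a) 1, - (be - de))])
   shiftM (- p.2) (p.1 * g))).
  by rewrite big_seq1 /= mulr1 opprK.
eexists; split; last by [].
by apply/funext => g; rewrite /fdo big_seq1 /= (pr_shift_right prP g dX dS).
Qed.

Section HtermAntipode.
Variable t : hterm A A.
Fact hterm_antipode_l : exists al, hdeg al (- hmid t) (SA (hright t)).
Proof. by have [be dr] := hright_deg t; exists (- be); exact: antipode_deg. Qed.
Fact hterm_antipode_r : exists be, hdeg (- hmid t) be (SA (hleft t)).
Proof. by have [al dl] := hleft_deg t; exists (- al); exact: antipode_deg. Qed.
Definition hterm_antipode := HTerm hterm_antipode_l hterm_antipode_r.
End HtermAntipode.

Lemma sweedler_antipode a :
  sweedler (Delta (SA a)) [seq hterm_antipode t | t <- sw_seq a].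
Proof. by rewrite /sweedler big_map sum_sw /= (Delta_antipode SAP). Qed.

(** With S a expanded by the reversed coproduct, both sides become
    \sum mu_r (<X, S a_1> 1) S(a_2). *)
Lemma antipode_ract X a : SA (right_action a (SU X)) = left_action X (SA a).
Proof.
move: X; apply: homog_ext => [X Y|X Y|al be X dX].
- by rewrite linearD (linear_add (ract_linX prP a)) linearD.
- exact: (linear_add (lact_linX prP _)).
move: a; apply: homog_ext => [a b|a b|ga de a da].
- by rewrite (linear_add (ract_lina prP _)) linearD.
- by rewrite linearD (linear_add (lact_lina prP X)).
rewrite (lact_sw prP X (sweedler_antipode a)) big_map sum_sw /=.
rewrite (ractE prP a (antipode_deg SUP dX)) linear_sum; apply: eq_bigr => i _.
have [dl dr] := sw_deg da i.
rewrite (pr_antipode dX dl) (antipode_mu_lM SAP _ dr) !shiftMD.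
by rewrite addrA subrK subrr shiftM0.
Qed.

Section HopfStarPairing.
Variables (cj : conjugation hs) (stA : A -> A).
Hypothesis stAP : is_hopf_star cj stA.
Let sA := hopf_star_star stAP.

(** Both types of star pairing give the same relation prY between X and an element Y: for the
    first type Y is the star of S X, for the second it is S of the dagger of X. The four
    identities only use this relation. *)
Section Twist.
Variables (al be : hs) (X Y : U).
Hypotheses (dX : hdeg al be X) (dY : hdeg (cj be) (cj al) Y).
Hypothesis prY : forall ga de b, hdeg ga de b ->
  pr Y b 1 = shiftM (- ga) (barM cj (pr X (stA b) 1)).

Lemma lact_twist a : left_action X (stA a) = stA (left_action Y a).
Proof.
move: a; apply: homog_ext => [a b|a b|ga de a da].
- by rewrite (starD sA) (linear_add (lact_lina prP X)).
- by rewrite (linear_add (lact_lina prP _)) (starD sA).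
rewrite (lact_sw prP X (sweedler_star stAP (sw_seqP a))) big_map sum_sw /=.
rewrite (lactE prP) (star_sum sA); apply: eq_bigr => i _; have [dl dr] := sw_deg da i.
rewrite (starM sA) (star_mu_r sA) (prY dr) barM_shift barMK conj_funN.
by rewrite (mu_r_shift _ (star_deg sA dl)).
Qed.

Lemma ract_twist a : right_action (stA a) X = stA (right_action a Y).
Proof.
move: a; apply: homog_ext => [a b|a b|ga de a da].
- by rewrite (starD sA) (linear_add (ract_lina prP X)).
- by rewrite (linear_add (ract_lina prP _)) (starD sA).
rewrite (ract_sw prP dX (sweedler_star stAP (sw_seqP a))) big_map sum_sw /=.
rewrite (ractE prP a dY) (star_sum sA); apply: eq_bigr => i _; have [dl dr] := sw_deg da i.
rewrite (starM sA) (star_mu_l sA) (prY dl) !barM_shift barMK conj_funN conj_involutive.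
rewrite (mulr_shift_l _ (star_deg sA dr)) opprK !shiftMD.
have dS := star_deg sA dl.
have [E|n] := eqVneq (al + - cj (mid a i)) (be + - cj ga).
  by rewrite -E addrC subrK.
by rewrite (pr_off prP dX dS n) !rmorph0.
Qed.
End Twist.

Lemma antipode_star_antipode b : SA (stA (SA b)) = stA b.
Proof. by rewrite -{1}[b](starK sA) (antipode_starK stAP SAP). Qed.

Lemma fdo_star_monomial P (f : M) w : P = (fun g => f * shiftM w g) ->
  fdo_star cj P (fun g => shiftM (- cj w) (barM cj f * g)).
Proof.
move=> ->; exists [:: (f, w)]; split; apply/funext => g.
  by rewrite /fdo big_seq1.
by rewrite big_seq1.
Qed.

(** Pairing the star of S X with b brings in S applied to the star of S b, which is the star
    of b by antipode_starK. *)
Lemma star_pairing_act stU : is_hopf_star cj stU -> is_star_pairing pr cj SA stA stU ->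
  forall X a, left_action X (stA a) = stA (left_action (stU (SU X)) a) /\
    right_action (stA a) X = stA (right_action a (stU (SU X))).
Proof.
move=> stUP sp X a; have sU := hopf_star_star stUP.
suff H : forall al be X, hdeg al be X ->
    left_action X (stA a) = stA (left_action (stU (SU X)) a) /\
    right_action (stA a) X = stA (right_action a (stU (SU X))).
  split; move: X; apply: homog_ext => [X Y|X Y|al be X dX].
  - exact: (linear_add (lact_linX prP _)).
  - by rewrite linearD (starD sU) (linear_add (lact_linX prP _)) (starD sA).
  - by have [] := H _ _ _ dX.
  - exact: (linear_add (ract_linX prP _)).
  - by rewrite linearD (starD sU) (linear_add (ract_linX prP _)) (starD sA).
  - by have [] := H _ _ _ dX.
move=> {X} al be X dX; have dS := antipode_deg SUP dX.
have dY : hdeg (cj be) (cj al) (stU (SU X)).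
  by have := star_deg sU dS; rewrite !conj_funN !opprK.
have prY ga de b : hdeg ga de b ->
    pr (stU (SU X)) b 1 = shiftM (- ga) (barM cj (pr X (stA b) 1)).
  move=> db; have dSb := antipode_deg SAP db; have dsSb := star_deg sA dSb.
  have E : pr (SU X) (stA (SA b)) = (fun g => pr (SU X) (stA (SA b)) 1 *
      shiftM (- (- be + - cj (- ga))) g).
    by apply/funext => g; exact: (pr_shift_left prP g dS dsSb).
  rewrite (sp _ _ _ _ _ db (fdo_star_monomial E)) /= rmorph1 mulr1.
  rewrite (pr_antipode dX dsSb) antipode_star_antipode barM_shift shiftMD.
  by rewrite -opprD !opprK addNr shiftM0.
by split; [exact: (lact_twist prY)|exact: (ract_twist dX dY prY)].
Qed.

Lemma dagger_pairing_act dgU : is_hopf_star cj dgU -> is_dagger_pairing pr cj SA stA dgU ->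
  forall X a, left_action X (stA a) = stA (left_action (SU (dgU X)) a) /\
    right_action (stA a) X = stA (right_action a (SU (dgU X))).
Proof.
move=> stUP sp X a; have sU := hopf_star_star stUP.
suff H : forall al be X, hdeg al be X ->
    left_action X (stA a) = stA (left_action (SU (dgU X)) a) /\
    right_action (stA a) X = stA (right_action a (SU (dgU X))).
  split; move: X; apply: homog_ext => [X Y|X Y|al be X dX].
  - exact: (linear_add (lact_linX prP _)).
  - by rewrite (starD sU) linearD (linear_add (lact_linX prP _)) (starD sA).
  - by have [] := H _ _ _ dX.
  - exact: (linear_add (ract_linX prP _)).
  - by rewrite (starD sU) linearD (linear_add (ract_linX prP _)) (starD sA).
  - by have [] := H _ _ _ dX.
move=> {X} al be X dX; have ds := star_deg sU dX.
have dY : hdeg (cj be) (cj al) (SU (dgU X)).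
  by have := antipode_deg SUP ds; rewrite !opprK.
have prY ga de b : hdeg ga de b ->
    pr (SU (dgU X)) b 1 = shiftM (- ga) (barM cj (pr X (stA b) 1)).
  move=> db; have dSb := antipode_deg SAP db; have dsb := star_deg sA db.
  have E : pr X (SA (stA (SA b))) = (fun g => pr X (stA b) 1 * shiftM (- (be + - cj ga)) g).
    by rewrite antipode_star_antipode; apply/funext => g; exact: (pr_shift_right prP g dX dsb).
  rewrite (pr_antipode ds db) (sp _ _ _ _ _ dSb (fdo_star_monomial E)) /= rmorph1 mulr1.
  rewrite (conj_funN _ (be - cj ga)) !opprK conj_funD conj_funN conj_involutive.
  by rewrite !shiftMD subrK addrA addNr add0r.
by split; [exact: (lact_twist prY)|exact: (ract_twist dX dY prY)].
Qed.
End HopfStarPairing.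
End Hopf.
End ModuleAlgebra.

Theorem theorem4p1 (R : realType) (h : vectType R[i])
    (U A : hBialgebroid h)
    (pr : U -> A -> mero 'Hom(h, R[i]^o) -> mero 'Hom(h, R[i]^o)) :
  is_pairing pr ->
  (exists! lact : U -> A -> A, is_left_act pr lact) /\
  (exists! ract : A -> U -> A, is_right_act pr ract) /\
  forall (lact : U -> A -> A) (ract : A -> U -> A),
    is_left_act pr lact -> is_right_act pr ract ->
    (forall al be ga de (X : U) (a : A), hdeg al be X -> hdeg ga de a ->
       hdeg ga (de + al - be) (lact X a) /\
       hdeg (ga + be - al) de (ract a X)) /\
    (forall X, linear (lact X)) /\ (forall X, linear (ract^~ X)) /\
    (forall a, lact 1 a = a) /\ (forall a, ract a 1 = a) /\
    (forall a X Y, ract a (X * Y) = ract (ract a X) Y) /\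
    (forall a X Y, lact (X * Y) a = lact X (lact Y a)) /\
    (forall a X Y, ract (lact X a) Y = lact X (ract a Y)) /\
    (forall X a b s, sweedler (Delta X) s ->
       lact X (a * b) = \sum_(t <- s) lact (hleft t) a * lact (hright t) b /\
       ract (a * b) X = \sum_(t <- s) ract a (hleft t) * ract b (hright t)) /\
    (forall X, lact X 1 = mu_r A (eps X 1)) /\
    (forall al be X, hdeg al be X -> ract 1 X = mu_l A (shiftM al (eps X 1))) /\
    (forall (SU : {linear U -> U}) (SA : {linear A -> A}),
       is_antipode SU -> is_antipode SA -> is_hopf_pairing pr SU SA ->
       forall X a, SA (ract a (SU X)) = lact X (SA a)) /\
    (forall (cj : conjugation 'Hom(h, R[i]^o)) (SU : {linear U -> U})
        (SA : {linear A -> A}) (stA : A -> A),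
       is_antipode SU -> is_antipode SA -> is_hopf_pairing pr SU SA ->
       bijective SU -> bijective SA -> is_hopf_star cj stA ->
       (forall stU : U -> U, is_hopf_star cj stU ->
          is_star_pairing pr cj SA stA stU ->
          forall X a,
            lact X (stA a) = stA (lact (stU (SU X)) a) /\
            ract (stA a) X = stA (ract a (stU (SU X)))) /\
       (forall dgU : U -> U, is_hopf_star cj dgU ->
          is_dagger_pairing pr cj SA stA dgU ->
          forall X a,
            lact X (stA a) = stA (lact (SU (dgU X)) a) /\
            ract (stA a) X = stA (ract a (SU (dgU X))))).
Proof.
move=> prP; split.
  by exists (left_action pr); split; [exact: left_action_act|move=> ? /(left_act_uniq prP) ->].
split.
  by exists (right_action pr); split; [exact: right_action_act|move=> ? /(right_act_uniq prP) ->].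
move=> lact ract /(left_act_uniq prP) -> /(right_act_uniq prP) ->.
split; first by move=> al be ga de X a dX da; split; [exact: lact_deg|exact: ract_deg].
split; first exact: lact_lina.
split; first exact: ract_lina.
split; first exact: lact_unit.
split; first exact: ract_unit.
split; first exact: ractM.
split; first exact: lactM.
split; first exact: lract_comm.
split; first by move=> X a b s sX; split; [exact: lact_mul|exact: ract_mul].
split; first exact: lact_one.
split; first exact: ract_one.
split; first by move=> SU SA SUP SAP hp X a; exact: antipode_ract.
move=> cj SU SA stA SUP SAP hp _ _ stAP; split=> stU stUP sp X a.
  exact: (star_pairing_act prP SUP SAP hp stAP stUP sp).
exact: (dagger_pairing_act prP SUP SAP hp stAP stUP sp).
Qed.
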